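(* Let $(\mathcal F,U)$ be a fixed $n$-dimensional system of fields and local relations. The association $X\mapsto \mathcal B_*(X;\mathcal F)$ (the blob complex of $X$) is a functor from the category of $n$-manifolds and homeomorphisms between them to the category of chain complexes and isomorphisms between them.
   Context: Conventions. All manifolds are compact, unoriented and piecewise linear (PL); ''homeomorphism'' means PL homeomorphism; a $k$-ball is any manifold homeomorphic to the standard $k$-ball; $I=[0,1]$; $X\setminus Y$ denotes the closure of the complement when $Y$ is a closed codimension-0 submanifold. System of fields. An $n$-dimensional system of fields $\mathcal F$ (enriched in vector spaces) consists of functors $\mathcal F$ from $k$-manifolds and homeomorphisms to sets, $0\le k\le n$, with: (1) natural restriction maps $\mathcal F(X)\to\mathcal F(\partial X)$; $\mathcal F(X;c)$ denotes the preimage of a boundary condition $c\in\mathcal F(\partial X)$. (2) If $\dim X=n$, each $\mathcal F(X;c)$ is a vector space, and all structure maps between fields on $n$-manifolds are linear. (3) $\mathcal F(X\sqcup W)\cong\mathcal F(X)\times\mathcal F(W)$ if $k<n$, and $\mathcal F(X\sqcup W;c\sqcup d)\cong\mathcal F(X;c)\otimes\mathcal F(W;d)$ if $k=n$, compatibly with homeomorphisms and boundary restriction. (4) Gluing: let $\partial X=(Y\sqcup Y)\cup W$ with $\partial(Y\sqcup Y)=\partial W$ (possibly empty), let $X_{gl}$ (resp. $W_{gl}$) be $X$ glued along the two copies of $Y$ (resp. $W$ glued along the two copies of $\partial Y$), let $c_{gl}\in\mathcal F(W_{gl})$ be splittable along $\partial Y$ and let $c\in\mathcal F(W)$ be its cut-open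 version. There is an injective gluing map from the equalizer of the two restriction maps $\{x\in\mathcal F(X): x|_W=c\}\rightrightarrows\mathcal F(Y)$ to $\mathcal F(X_{gl};c_{gl})$, compatible with homeomorphisms, boundary restriction and disjoint union, and surjective up to homeomorphisms of $X_{gl}$ isotopic to the identity and collar maps (below). Fields in its image are called splittable along $Y$. Gluing of $x_1$ and $x_2$ is denoted $x_1\bullet x_2$. (5) For $c\in\mathcal F(X)$ and a properly embedded codimension-1 submanifold $Y\subset X$, $c$ splits along most (e.g. an open dense set of) small perturbations of $Y$. (6) Product fields: natural maps $\mathcal F(Y)\to\mathcal F(Y\times I)$, $c\mapsto c\times I$, commuting with all the structure above, with $f(c\times I)=\bar f(c)\times I$ for every fiber-preserving homeomorphism $f$ of $Y\times I$ covering $\bar f:Y\to Y$. For $Y\subset\partial M$ of codimension 0, a collaring homeomorphism is a homeomorphism $f:M\cup(Y\times I)\to M$ ($Y\times I$ glued to $M$ along $Y$) which is the identity outside a bicollar of $Y$ and preserves the fibers of the bicollar; the associated collar map is $x\mapsto f(x\bullet(x|_Y\times I))$, for $x\in\mathcal F(M)$ with $\partial x$ splittable along $\partial Y$. Extended isotopy is the equivalence relation generated by collar maps and homeomorphisms isotopic to the identity. Local relations. $U$ assigns to each $n$-ball $B$ and $c\in\mathcal F(\partial B)$ a subspace $U(B;c)\subset\mathcal F(B;c)$ such that: $f(U(B;c))=U(B';f(c))$ for homeomorphisms $f:B\to B'$; $x-y\in U(B;c)$ if $x,y\in\mathcal F(B;c)$ are extended isotopic; and if $B=B'\cup B''$,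 $x\in U(B')$, $r\in\mathcal F(B'')$, then $x\bullet r\in U(B)$. Blob complex. A gluing decomposition of an $n$-manifold $X$ is a sequence $M_0\to M_1\to\cdots\to M_m=X$ of manifolds in which $M_i$ is obtained from $M_{i-1}$ by gluing together a disjoint pair of homeomorphic $(n-1)$-manifolds in $\partial M_{i-1}$. A field on $X$ is splittable along it if it is the image under gluing and disjoint union of fields on the components of $M_0$. A configuration of $k$ blobs in $X$ is an ordered collection of $k$ subsets $B_1,\dots,B_k$ of $X$ for which there is a gluing decomposition (called compatible with the configuration) such that each $B_i$ is the image in $X$ of a connected component of some $M_l$ which is a ball. $B_i$ is a twig blob if no other $B_j$ is a strict subset of it. A $k$-blob diagram is a configuration $\{B_1,\dots,B_k\}$ together with a field $r\in\mathcal F(X)$ splittable along some gluing decomposition compatible with the configuration, such that the restriction of $r$ to (the ball whose image is) each twig blob $B_i$ lies in $U(B_i)$. $\mathcal B_k(X)=\mathcal B_k(X;\mathcal F)$ is the direct sum over all configurations of $k$ blobs of the vector space of $k$-blob diagrams with that configuration (for instance, for one blob $B$ this space is $\bigoplus_{c\in\mathcal F(\partial B)}U(B;c)\otimes\mathcal F(X\setminus B;c)$), modulo identifying the spaces for configurations which differ by a permutation of the blobs via the sign of the permutation. In particular $\mathcal B_0(X)=\mathcal F(X)$. The differential is $\partial(\{B_1,\dots,B_k\},r)=\sum_{i=1}^k(-1)^{i+1}(\{B_1,\dots,\widehat{B_i},\dots,B_k\},r)$. If $\partial X\ne\emptyset$, a boundary condition $c\in\mathcal F(\partial X)$ is fixed,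 $\mathcal B_0(X;c)=\mathcal F(X;c)$ etc., and $c$ is usually omitted from the notation (homeomorphisms carry boundary conditions along). *)

(* Defs.v *)
From HB Require Import structures.
From mathcomp Require Import all_boot all_order all_algebra all_fingroup.
From mathcomp Require Import all_classical all_reals all_analysis.
From mathcomp.multinomials Require Import freeg.

Set Implicit Arguments.
Unset Strict Implicit.
Unset Printing Implicit Defensive.
Import Order.TTheory GRing.Theory Num.Theory numFieldNormedType.Exports.
Local Open Scope classical_set_scope.
Local Open Scope ring_scope.

(** * Piecewise linear topology

    A compact PL manifold is represented by a compact polyhedron in some R^N.
    Every compact PL manifold embeds in some R^N, so this category is
    equivalent to that of abstract compact PL manifolds. *)

Section PL.
Variable R : realType.

Record space := Space { amb : nat; car : set 'rV[R]_amb }.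
Arguments car : clear implicits.

Definition pt (X : space) : Type := {x : 'rV[R]_(amb X) | car X x}.
Coercion pt : space >-> Sortclass.

Lemma pt_inj (X : space) (x y : X) : sval x = sval y -> x = y.
Proof. by case: x y => [x hx] [y hy] /= e; exact: eq_exist. Qed.

(* A system of linear inequalities [x *m h.1 <= h.2]; the set of its solutions
   is a closed convex polyhedron. *)
Definition cell N := seq ('cV[R]_N * R).

Definition in_cell N (Q : cell N) (x : 'rV[R]_N) : Prop :=
  forall h, h \in Q -> (x *m h.1) 0 0 <= h.2.

Definition polyhedron N (A : set 'rV[R]_N) : Prop :=
  exists s : seq (cell N), A = [set x | exists2 Q, Q \in s & in_cell Q x].

(* [f] is affine on each piece of a finite cover of [X] by closed convex
   polyhedra; in particular it is continuous. *)
Definition pl (X Y : space) (f : X -> Y) : Prop :=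
  exists s : seq (cell (amb X) * ('M[R]_(amb X, amb Y) * 'rV[R]_(amb Y))),
    forall x : X,
      (exists2 p, p \in s & in_cell p.1 (sval x)) /\
      (forall p, p \in s -> in_cell p.1 (sval x) ->
        sval (f x) = sval x *m p.2.1 + p.2.2).

(* As all spaces below are compact polyhedra, a PL injection is automatically
   a PL homeomorphism onto its image. *)
Definition embedding (X Y : space) (f : X -> Y) : Prop := pl f /\ injective f.

Record homeo (X Y : space) := Homeo {
  hfun :> X -> Y;
  hinv : Y -> X;
  hfunK : cancel hfun hinv;
  hinvK : cancel hinv hfun;
  hfun_pl : pl hfun;
  hinv_pl : pl hinv }.
Arguments hinv {X Y} h _.

Lemma homeo_eq X Y (f g : homeo X Y) : hfun f =1 hfun g -> f = g.
Proof.
case: f g => [f f' fK f'K pf pf'] [g g' gK g'K pg pg'] /= e.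
have e1 : f = g by apply/funext.
subst g; have e2 : f' = g'.
  by apply/funext => y; rewrite -{1}(g'K y) fK.
subst g'; congr Homeo; exact: Prop_irrelevance.
Qed.

Lemma pl_id X : pl (@id (pt X)).
Proof.
exists [:: ([::], (1%:M, 0))] => x; split.
  by exists ([::], (1%:M, 0)); rewrite ?mem_head.
by move=> p; rewrite inE => /eqP -> _ /=; rewrite mulmx1 addr0.
Qed.

Lemma pl_comp (X Y Z : space) (g : Y -> Z) (f : X -> Y) : pl g -> pl f -> pl (g \o f).
Proof.
move=> [t ht] [s hs].
pose pull (p : cell (amb X) * ('M[R]_(amb X, amb Y) * 'rV[R]_(amb Y)))
    (q : cell (amb Y) * ('M[R]_(amb Y, amb Z) * 'rV[R]_(amb Z))) :=
  (p.1 ++ [seq (p.2.1 *m h.1, h.2 - (p.2.2 *m h.1) 0 0) | h <- q.1],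
   (p.2.1 *m q.2.1, p.2.2 *m q.2.1 + q.2.2)).
have pullP p q (x : X) : p \in s ->
    (in_cell (pull p q).1 (sval x) <->
     in_cell p.1 (sval x) /\ in_cell q.1 (sval (f x))).
  move=> ps; have key : in_cell p.1 (sval x) -> forall h : 'cV[R]_(amb Y) * R,
      ((sval x *m (p.2.1 *m h.1)) 0 0 <= h.2 - (p.2.2 *m h.1) 0 0) =
      ((sval (f x) *m h.1) 0 0 <= h.2).
    move=> hp h; rewrite (proj2 (hs x) p ps hp) mulmxDl -mulmxA.
    by rewrite [in RHS]mxE lerBrDr.
  split=> [h|[hp hq] h].
    have hp : in_cell p.1 (sval x).
      by move=> k kp; apply: h; rewrite mem_cat kp.
    split=> // k kq; rewrite -(key hp).
    apply: (h (p.2.1 *m k.1, k.2 - (p.2.2 *m k.1) 0 0)).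
    by rewrite mem_cat; apply/orP; right; apply/mapP; exists k.
  rewrite mem_cat => /orP[/hp //|/mapP[k kq ->]] /=.
  by rewrite key //; exact: hq.
exists [seq pull p q | p <- s, q <- t] => x; split.
  have [[p ps hp] _] := hs x; have [[q qt hq] _] := ht (f x).
  exists (pull p q); first by apply/allpairsP; exists (p, q).
  exact/pullP.
move=> _ /allpairsP[[p q] /= [ps qt ->]] /(pullP _ _ _ ps)[hp hq] /=.
rewrite (proj2 (ht (f x)) q qt hq) (proj2 (hs x) p ps hp).
by rewrite mulmxDl addrA mulmxA.
Qed.

Definition homeo_id X : homeo X X :=
  Homeo (fun=> erefl) (fun=> erefl) (pl_id X) (pl_id X).

Definition homeo_comp X Y Z (g : homeo Y Z) (f : homeo X Y) : homeo X Z :=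
  Homeo (can_comp (hfunK g) (hfunK f)) (can_comp (hinvK f) (hinvK g))
    (pl_comp (hfun_pl g) (hfun_pl f)) (pl_comp (hinv_pl f) (hinv_pl g)).

Definition homeo_inv X Y (f : homeo X Y) : homeo Y X :=
  Homeo (hinvK f) (hfunK f) (hinv_pl f) (hfun_pl f).

Definition cube k : space :=
  @Space k [set x | forall i, 0 <= x 0 i <= 1].

(* The point [p] of [X] has a neighbourhood that is a PL [k]-cube. *)
Definition chart k (X : space) (p : X) (phi : cube k -> X) : Prop :=
  embedding phi /\
  (\forall y \near sval p, car X y -> exists c, sval (phi c) = y).

Definition chart_at k (X : space) (p : X) : Prop :=
  exists phi : cube k -> X, chart p phi.

Definition inner k (X : space) (p : X) : Prop :=
  exists phi : cube k -> X, chart p phi /\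
    exists2 c, phi c = p & forall i, 0 < sval c 0 i < 1.

(** The index of a manifold is its dimension plus one: [mfd d] is the type of
    compact PL manifolds of dimension [d - 1], and an [mfd 0] is the empty
    manifold of dimension [-1], the boundary of a 0-manifold. *)

Definition bdspace d (X : space) : space :=
  @Space (amb X) [set x | exists p : X, sval p = x /\ ~ inner d.-1 p].

(* That the boundary is a manifold of one dimension less is a theorem; it is
   included here to make the boundary a total operation. *)
Fixpoint is_mfd d (X : space) : Prop :=
  match d with
  | 0 => car X = set0
  | d'.+1 => [/\ polyhedron (car X), compact (car X),
                forall p : X, chart_at d' p & is_mfd d' (bdspace d X)]
  end.

Record mfd d := Mfd { sp :> space; spP : is_mfd d sp }.

Lemma bdspace_mfd d (X : mfd d) : is_mfd d.-1 (bdspace d X).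
Proof.
case: d X => [|d] [X /=]; last by case.
move=> h; rewrite -subset0 => x [[p hp] _]; by rewrite h in hp.
Qed.

Definition bdy d (X : mfd d) : mfd d.-1 := Mfd (bdspace_mfd X).

Lemma incl_subproof d (X : mfd d) (p : bdy X) : car X (sval p).
Proof. by case: p => _ /= [q [<- _]]; exact: (svalP q). Qed.

Definition incl d (X : mfd d) (p : bdy X) : X :=
  exist _ (sval p) (incl_subproof p).

Definition is_ball d (X : mfd d.+1) : Prop := inhabited (homeo X (cube d)).

(* [g] is the restriction of [f] to the boundary. *)
Definition restricts d (X Y : mfd d) (f : homeo X Y)
    (g : homeo (bdy X) (bdy Y)) : Prop :=
  forall p, incl (g p) = f (incl p).

(* X x I *)
Definition prodI (X : space) : space :=
  @Space (amb X + 1)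
    [set x | car X (lsubmx x) /\ 0 <= (rsubmx x : 'rV[R]_1) 0 0 <= 1].

Definition prX (X : space) (p : prodI X) : X :=
  exist _ (lsubmx (sval p)) (proj1 (svalP p)).

Definition prT (X : space) (p : prodI X) : R := (rsubmx (sval p) : 'rV[R]_1) 0 0.

(* [f] is isotopic to the identity through a level-preserving homeomorphism. *)
Definition isotopic_id (X : space) (f : homeo X X) : Prop :=
  exists H : homeo (prodI X) (prodI X), forall p : prodI X,
    [/\ prT (H p) = prT p, (prT p = 0 -> prX (H p) = prX p)
      & (prT p = 1 -> prX (H p) = f (prX p))].

(* A presentation of [Z] as the disjoint union of [X] and [W]. *)
Record dsum d (X W Z : mfd d) := Dsum {
  dl : X -> Z;
  dr : W -> Z;
  dl_emb : embedding dl;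
  dr_emb : embedding dr;
  dsum_disj : forall x w, dl x <> dr w;
  dsum_cover : forall z, (exists x, dl x = z) \/ (exists w, dr w = z) }.
Arguments dl {d X W Z} D _ : rename.
Arguments dr {d X W Z} D _ : rename.

(* A presentation of [Xgl] as [X] glued along two disjoint copies of [gY] in
   its boundary, where bdX = (gY u gY) u gW with bd(gY u gY) = bd gW. *)
Record gluing d (X Xgl : mfd d) := Gluing {
  gY : mfd d.-1;
  gW : mfd d.-1;
  gj1 : gY -> bdy X;
  gj2 : gY -> bdy X;
  gk : gW -> bdy X;
  gq : X -> Xgl;
  gj1_emb : embedding gj1;
  gj2_emb : embedding gj2;
  gk_emb : embedding gk;
  gq_pl : pl gq;
  gq_surj : forall z, exists x, gq x = z;
  gj_disj : forall y y', gj1 y <> gj2 y';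
  g_cover : forall b, (exists y, b = gj1 y \/ b = gj2 y) \/ (exists w, b = gk w);
  g_meet : forall y w, gj1 y = gk w \/ gj2 y = gk w ->
    (exists y0 : bdy gY, incl y0 = y) /\ (exists w0 : bdy gW, incl w0 = w);
  g_bdY : forall y0 : bdy gY,
    (exists w0 : bdy gW, gj1 (incl y0) = gk (incl w0)) /\
    (exists w0 : bdy gW, gj2 (incl y0) = gk (incl w0));
  g_bdW : forall w0 : bdy gW, exists y0 : bdy gY,
    gj1 (incl y0) = gk (incl w0) \/ gj2 (incl y0) = gk (incl w0);
  gq_fib : forall p p', gq p = gq p' <->
    [\/ p = p', (exists y, p = incl (gj1 y) /\ p' = incl (gj2 y))
      | (exists y, p = incl (gj2 y) /\ p' = incl (gj1 y))] }.
Arguments gj1 {d X Xgl} G _ : rename.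
Arguments gj2 {d X Xgl} G _ : rename.
Arguments gk {d X Xgl} G _ : rename.
Arguments gq {d X Xgl} G _ : rename.

(* The boundary of [X] as (gY + gY) + gW glued along bd(gY + gY) = bd gW. *)
Record cutbd d (X Xgl : mfd d) (G : gluing X Xgl) := Cutbd {
  cb1 : mfd d.-1;
  cb2 : mfd d.-1;
  cbYY : dsum (gY G) (gY G) cb1;
  cbYYW : dsum cb1 (gW G) cb2;
  cbG : gluing cb2 (bdy X);
  cb_j1 : forall y, gq cbG (dl cbYYW (dl cbYY y)) = gj1 G y;
  cb_j2 : forall y, gq cbG (dl cbYYW (dr cbYY y)) = gj2 G y;
  cb_k : forall w, gq cbG (dr cbYYW w) = gk G w;
  cb_sideY : forall t, exists p, incl (gj1 cbG t) = dl cbYYW p;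
  cb_sideW : forall t, exists w, incl (gj2 cbG t) = dr cbYYW w }.

(* [G'] presents the boundary of [Xgl] as [gW] glued along the two copies of
   the boundary of [gY]. *)
Definition glued_bd d (X Xgl : mfd d) (G : gluing X Xgl)
    (G' : gluing (gW G) (bdy Xgl)) : Prop :=
  (forall w, incl (gq G' w) = gq G (incl (gk G w))) /\
  exists h : homeo (gY G') (bdy (gY G)), forall t,
    gk G (incl (gj1 G' t)) = gj1 G (incl (h t)) /\
    gk G (incl (gj2 G' t)) = gj2 G (incl (h t)).

(* A collaring homeomorphism of [M] along Y = [gY clG].  Here [clP] is Y x I,
   glued to [M] along Y = Y x 0 to give [clN].  The bicollar is the union of
   Y x I and of the collar [clK] of Y in [M], and its fibre over y consists of
   y x I and of the fibre of [clK] over y. *)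
Record collaring d (M : mfd d.+1) := Collaring {
  clP : mfd d.+1;
  clZ : mfd d.+1;
  clN : mfd d.+1;
  clD : dsum M clP clZ;
  clG : gluing clZ clN;
  clH : homeo clP (prodI (gY clG));
  clj : gY clG -> bdy M;
  clK : prodI (gY clG) -> M;
  clf : homeo clN M;
  cl_j1 : forall y, incl (gj1 clG y) = dl clD (incl (clj y));
  cl_j2 : forall y, exists2 p, incl (gj2 clG y) = dr clD p
                             & prX (clH p) = y /\ prT (clH p) = 0;
  clK_emb : embedding clK;
  clK0 : forall p, prT p = 0 -> clK p = incl (clj (prX p));
  clf_out : forall m, ~ (exists p, clK p = m) -> clf (gq clG (dl clD m)) = m;
  clf_fibM : forall p, exists2 p', prX p' = prX p
                                 & clf (gq clG (dl clD (clK p))) = clK p';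
  clf_fibP : forall p, exists2 p', prX p' = prX (clH p)
                                 & clf (gq clG (dr clD p)) = clK p' }.

End PL.

Arguments car {R} s _ : rename.
Arguments hinv {R X Y} h _.
Arguments dl {R d X W Z} D _ : rename.
Arguments dr {R d X W Z} D _ : rename.
Arguments gj1 {R d X Xgl} G _ : rename.
Arguments gj2 {R d X Xgl} G _ : rename.
Arguments gk {R d X Xgl} G _ : rename.
Arguments gq {R d X Xgl} G _ : rename.

(** * Systems of fields *)

Section FieldData.
Variables (R : realType) (K : fieldType) (n : nat).
Local Notation mfd := (mfd R).

(* The structure of an n-dimensional system of fields.  The n-manifolds are
   those of type [mfd n.+1], and the values at [mfd d] with d > n + 1 are
   irrelevant.  For X of dimension n, the vector space F(X; c) is [vs c],
   identified by [vec] with the set of all x in F(X) restricting to c.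
   Gluing maps being partially defined, they are given by their graphs. *)
Record field_data := FieldData {
  fld : forall d, mfd d -> Type;
  act : forall d (X Y : mfd d), homeo X Y -> fld X -> fld Y;
  res : forall d (X : mfd d), fld X -> fld (bdy X);
  vs : forall X : mfd n.+1, fld (bdy X) -> lmodType K;
  vec : forall (X : mfd n.+1) (c : fld (bdy X)), vs c -> fld X;
  dju : forall d (X W Z : mfd d), dsum X W Z -> fld X -> fld W -> fld Z;
  glued : forall d (X Xgl : mfd d), gluing X Xgl -> fld X -> fld Xgl -> Prop;
  timesI : forall d (Y : mfd d) (P : mfd d.+1),
    homeo P (prodI Y) -> fld Y -> fld P }.

Variable F : field_data.

(* z = a x + y in some F(X; c). *)
Definition lincomb (a : K) (X : mfd n.+1) (x y z : fld F X) : Prop :=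
  exists c (u v : vs c), [/\ x = vec u, y = vec v & z = vec (a *: u + v)].

(* The boundary of x is splittable, with restrictions y1 and y2 to the two
   copies of Y and w to W. *)
Definition restr d (X Xgl : mfd d) (G : gluing X Xgl) (x : fld F X)
    (y1 y2 : fld F (gY G)) (w : fld F (gW G)) : Prop :=
  exists C : cutbd G,
    glued (cbG C) (dju (cbYYW C) (dju (cbYY C) y1 y2) w) (res x).

Definition collar_map d (M : mfd d.+1) (C : collaring M) (x x' : fld F M) : Prop :=
  exists e w z,
    [/\ restr (G := clG C) (dju (clD C) x (timesI (clH C) e)) e e w,
        glued (clG C) (dju (clD C) x (timesI (clH C) e)) z
      & x' = act (clf C) z].

(* Extended isotopy. *)
Inductive ext_isotopic : forall d (X : mfd d), fld F X -> fld F X -> Prop :=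
| ei_refl d (X : mfd d) x : @ext_isotopic d X x x
| ei_sym d (X : mfd d) x y : @ext_isotopic d X x y -> @ext_isotopic d X y x
| ei_trans d (X : mfd d) x y z :
    @ext_isotopic d X x y -> @ext_isotopic d X y z -> @ext_isotopic d X x z
| ei_isotopy d (X : mfd d) (f : homeo X X) x :
    isotopic_id f -> @ext_isotopic d X x (act f x)
| ei_collar d (M : mfd d.+1) (C : collaring M) x x' :
    collar_map C x x' -> @ext_isotopic d.+1 M x x'.

(* The image of the gluing map whose target is F(Xgl; w glued).  In dimension
   n the equalizer is the union over e in F(Y) of the vector spaces of fields
   on X restricting to e on both copies of Y; its linear counterpart is their
   direct sum, and the image is the subspace spanned by the glued fields. *)
Inductive split : forall d (X Xgl : mfd d) (G : gluing X Xgl),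
    fld F (gW G) -> fld F Xgl -> Prop :=
| split_glued d (X Xgl : mfd d) (G : gluing X Xgl) w x e z :
    restr (G := G) x e e w -> glued G x z -> split w z
| split_zero (X Xgl : mfd n.+1) (G : gluing X Xgl)
    (G' : gluing (gW G) (bdy Xgl)) (w : fld F (gW G)) (c : fld F (bdy Xgl)) :
    glued_bd G' -> glued G' w c -> @split n.+1 X Xgl G w (vec (0 : vs c))
| split_lin (X Xgl : mfd n.+1) (G : gluing X Xgl) w a (z1 z2 z : fld F Xgl) :
    @split n.+1 X Xgl G w z1 -> @split n.+1 X Xgl G w z2 ->
    lincomb a z1 z2 z -> @split n.+1 X Xgl G w z.

(* A sequence of gluings from [M] to [X]; the last manifold of the sequence is
   identified with [X] by a homeomorphism. *)
Inductive decomp d (X : mfd d) : mfd d -> Type :=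
| Done (M : mfd d) : homeo M X -> decomp X M
| Step (M M' : mfd d) : gluing M M' -> decomp X M' -> decomp X M.

Fixpoint total_map d (X M : mfd d) (s : decomp X M) : M -> X :=
  match s with
  | Done M h => h
  | Step M M' G s' => fun p => total_map s' (gq G p)
  end.

Fixpoint total_glued d (X M : mfd d) (s : decomp X M) : fld F M -> fld F X -> Prop :=
  match s with
  | Done M h => fun x r => r = act h x
  | Step M M' G s' => fun x r => exists2 x', glued G x x' & total_glued s' x' r
  end.

(* The [l]-th manifold of the sequence (the last one, if [l] is too large). *)
Fixpoint stage d (X M : mfd d) (s : decomp X M) (l : nat) : mfd d :=
  match s with
  | Done M _ => M
  | Step M _ _ s' => if l is l'.+1 then stage s' l' else M
  end.

Fixpoint stage_map d (X M : mfd d) (s : decomp X M) : forall l, stage s l -> X :=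
  match s with
  | Done M h => fun l p => h p
  | Step M M' G s' => fun l =>
      match l with
      | 0 => fun p => total_map s' (gq G p)
      | l'.+1 => fun p => @stage_map _ _ _ s' l' p
      end
  end.

(* The field on the [l]-th stage obtained from a field on [M] by gluing. *)
Fixpoint stage_glued d (X M : mfd d) (s : decomp X M) :
    forall l, fld F M -> fld F (stage s l) -> Prop :=
  match s with
  | Done M h => fun l x y => y = x
  | Step M M' G s' => fun l =>
      match l with
      | 0 => fun x y => y = x
      | l'.+1 => fun x y => exists2 x', glued G x x' & @stage_glued _ _ _ s' l' x' y
      end
  end.

End FieldData.

Arguments lincomb {R K n} F a {X} x y z.
Arguments restr {R K n} F {d X Xgl} G x y1 y2 w.
Arguments split {R K n} F {d X Xgl} G w z.
Arguments total_glued {R K n} F {d X M} s x r.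
Arguments stage_glued {R K n} F {d X M} s l x y.
Arguments stage_map {R d X M} s l p.

Section Fields.
Variables (R : realType) (K : fieldType) (n : nat).
Local Notation mfd := (mfd R).

Record is_fields (F : field_data R K n) : Prop := IsFields {
  (* functoriality and boundary restriction *)
  act_id : forall d, (d <= n.+1)%N -> forall (X : mfd d) (x : fld F X),
    act (homeo_id X) x = x;
  act_comp : forall d, (d <= n.+1)%N ->
    forall (X Y Z : mfd d) (g : homeo Y Z) (f : homeo X Y) (x : fld F X),
    act (homeo_comp g f) x = act g (act f x);
  act_res : forall d, (d <= n.+1)%N ->
    forall (X Y : mfd d) (f : homeo X Y) (g : homeo (bdy X) (bdy Y)),
    restricts f g -> forall x : fld F X, res (act f x) = act g (res x);
  fld_empty : forall d, (d <= n)%N -> forall X : mfd d, car X = set0 ->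
    exists x : fld F X, forall y, y = x;

  (* vector spaces *)
  vec_inj : forall (X : mfd n.+1) (c : fld F (bdy X)),
    injective (vec (X := X) (c := c));
  vec_image : forall (X : mfd n.+1) (c : fld F (bdy X)) (x : fld F X),
    res x = c <-> exists u : vs c, vec u = x;
  act_lin : forall (X Y : mfd n.+1) (f : homeo X Y) a (x y z : fld F X),
    lincomb F a x y z -> lincomb F a (act f x) (act f y) (act f z);

  (* disjoint unions *)
  dju_bij : forall d, (d <= n)%N ->
    forall (X W Z : mfd d) (D : dsum X W Z),
    bijective (fun p : fld F X * fld F W => dju D p.1 p.2);
  dju_tensor : forall (X W Z : mfd n.+1) (D : dsum X W Z)
      (D' : dsum (bdy X) (bdy W) (bdy Z)),
    (forall p, incl (dl D' p) = dl D (incl p)) ->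
    (forall p, incl (dr D' p) = dr D (incl p)) ->
    forall (c : fld F (bdy X)) (c' : fld F (bdy W)),
    exists T : vs c -> vs c' -> vs (dju D' c c'),
    [/\ (forall u, linear (T u)), (forall v, linear (T^~ v)),
        (forall u v, vec (T u v) = dju D (vec u) (vec v))
      & forall (E : lmodType K) (phi : vs c -> vs c' -> E),
          (forall u, linear (phi u)) -> (forall v, linear (phi^~ v)) ->
          exists! psi : vs (dju D' c c') -> E,
            linear psi /\ forall u v, psi (T u v) = phi u v];
  dju_act : forall d, (d <= n.+1)%N ->
    forall (X W Z X' W' Z' : mfd d) (D : dsum X W Z) (D' : dsum X' W' Z')
      (f : homeo X X') (g : homeo W W') (h : homeo Z Z'),
    (forall x, h (dl D x) = dl D' (f x)) ->
    (forall w, h (dr D w) = dr D' (g w)) ->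
    forall (x : fld F X) (w : fld F W),
    act h (dju D x w) = dju D' (act f x) (act g w);
  dju_res : forall d, (d <= n.+1)%N ->
    forall (X W Z : mfd d) (D : dsum X W Z) (D' : dsum (bdy X) (bdy W) (bdy Z)),
    (forall p, incl (dl D' p) = dl D (incl p)) ->
    (forall p, incl (dr D' p) = dr D (incl p)) ->
    forall (x : fld F X) (w : fld F W),
    res (dju D x w) = dju D' (res x) (res w);
  dju_sym : forall d, (d <= n.+1)%N ->
    forall (X W Z : mfd d) (D : dsum X W Z) (D' : dsum W X Z),
    (forall w, dl D' w = dr D w) -> (forall x, dr D' x = dl D x) ->
    forall (x : fld F X) (w : fld F W), dju D' w x = dju D x w;
  dju_assoc : forall d, (d <= n.+1)%N ->
    forall (X Y W XY YW Z : mfd d) (D1 : dsum X Y XY) (D2 : dsum XY W Z)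
      (D3 : dsum Y W YW) (D4 : dsum X YW Z),
    (forall x, dl D2 (dl D1 x) = dl D4 x) ->
    (forall y, dl D2 (dr D1 y) = dr D4 (dl D3 y)) ->
    (forall w, dr D2 w = dr D4 (dr D3 w)) ->
    forall (x : fld F X) (y : fld F Y) (w : fld F W),
    dju D2 (dju D1 x y) w = dju D4 x (dju D3 y w);

  (* gluing: the domain is the equalizer *)
  glued_dom : forall d, (d <= n.+1)%N ->
    forall (X Xgl : mfd d) (G : gluing X Xgl) (x : fld F X),
    (exists z, glued G x z) <-> (exists e w, restr F G x e e w);
  (* this starts the recursion on the dimension in [restr] *)
  glued_empty : forall (X Xgl : mfd 0) (G : gluing X Xgl)
    (x : fld F X) (z : fld F Xgl), glued G x z;
  glued_fun : forall d, (d <= n.+1)%N ->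
    forall (X Xgl : mfd d) (G : gluing X Xgl) (x : fld F X) (z z' : fld F Xgl),
    glued G x z -> glued G x z' -> z = z';
  glued_lin : forall (X Xgl : mfd n.+1) (G : gluing X Xgl) a
      (x y z : fld F X) (x' y' : fld F Xgl),
    lincomb F a x y z -> glued G x x' -> glued G y y' ->
    exists2 z', glued G z z' & lincomb F a x' y' z';
  (* injectivity; in dimension n, that of the linear map defined on the direct
     sum over e in F(Y) *)
  glued_inj : forall d, (d <= n)%N ->
    forall (X Xgl : mfd d) (G : gluing X Xgl) w e e' (x x' : fld F X) z,
    restr F G x e e w -> restr F G x' e' e' w ->
    glued G x z -> glued G x' z -> x = x';
  glued_inj_top : forall (X Xgl : mfd n.+1) (G : gluing X Xgl) w e
      (x x' : fld F X) z,
    restr F G x e e w -> restr F G x' e e w ->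
    glued G x z -> glued G x' z -> x = x';
  glued_indep : forall (X Xgl : mfd n.+1) (G : gluing X Xgl) w
      (c : fld F (bdy Xgl)) m (e : 'I_m -> fld F (gY G)) (x : 'I_m -> fld F X)
      (u : 'I_m -> vs c),
    injective e ->
    (forall i, restr F G (x i) (e i) (e i) w /\ glued G (x i) (vec (u i))) ->
    \sum_i u i = 0 -> forall i, u i = 0;
  glued_surj : forall d, (d <= n.+1)%N ->
    forall (X Xgl : mfd d) (G : gluing X Xgl) (G' : gluing (gW G) (bdy Xgl)),
    glued_bd G' -> forall (w : fld F (gW G)) (z : fld F Xgl),
    glued G' w (res z) -> exists2 z', ext_isotopic z z' & split F G w z';
  glued_act : forall d, (d <= n.+1)%N ->
    forall (X Xgl X' Xgl' : mfd d) (G : gluing X Xgl) (G' : gluing X' Xgl')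
      (f : homeo X X') (fgl : homeo Xgl Xgl') (fY : homeo (gY G) (gY G')),
    (forall p, fgl (gq G p) = gq G' (f p)) ->
    (forall y, f (incl (gj1 G y)) = incl (gj1 G' (fY y))) ->
    (forall y, f (incl (gj2 G y)) = incl (gj2 G' (fY y))) ->
    forall (x : fld F X) (z : fld F Xgl),
    glued G x z -> glued G' (act f x) (act fgl z);
  glued_res : forall d, (d <= n.+1)%N ->
    forall (X Xgl : mfd d) (G : gluing X Xgl) (G' : gluing (gW G) (bdy Xgl)),
    glued_bd G' -> forall (x : fld F X) (z : fld F Xgl) e w,
    restr F G x e e w -> glued G x z -> glued G' w (res z);
  glued_dju : forall d, (d <= n.+1)%N ->
    forall (A A' B B' X X' : mfd d) (GA : gluing A A') (GB : gluing B B')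
      (G : gluing X X') (D : dsum A B X) (D' : dsum A' B' X')
      (DY : dsum (gY GA) (gY GB) (gY G)),
    (forall p, gq G (dl D p) = dl D' (gq GA p)) ->
    (forall p, gq G (dr D p) = dr D' (gq GB p)) ->
    (forall y, incl (gj1 G (dl DY y)) = dl D (incl (gj1 GA y))) ->
    (forall y, incl (gj2 G (dl DY y)) = dl D (incl (gj2 GA y))) ->
    (forall y, incl (gj1 G (dr DY y)) = dr D (incl (gj1 GB y))) ->
    (forall y, incl (gj2 G (dr DY y)) = dr D (incl (gj2 GB y))) ->
    forall (a : fld F A) (a' : fld F A') (b : fld F B) (b' : fld F B'),
    glued GA a a' -> glued GB b b' -> glued G (dju D a b) (dju D' a' b');

  (* splitting along small perturbations: [act (homeo_inv h) c] splits along
     the image Y of [gY G] if and only if c splits along h(Y); the perturbations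
     along which c splits are required to be dense *)
  splits_perturb : forall d, (d <= n.+1)%N ->
    forall (Xcut X : mfd d) (G : gluing Xcut X) (c : fld F X) (eps : R),
    0 < eps -> exists h : homeo X X,
    [/\ isotopic_id h, (forall p i, `|sval (h p) 0 i - sval p 0 i| < eps)
      & exists w, split F G w (act (homeo_inv h) c)];

  (* product fields *)
  timesI_act : forall d, (d <= n)%N ->
    forall (Y Y' : mfd d) (P P' : mfd d.+1) (h : homeo P (prodI Y))
      (h' : homeo P' (prodI Y')) (f : homeo P P') (g : homeo Y Y'),
    (forall p, prX (h' (f p)) = g (prX (h p))) ->
    forall c : fld F Y, act f (timesI h c) = timesI h' (act g c);
  timesI_dju : forall d, (d <= n)%N ->
    forall (Y1 Y2 Y : mfd d) (P1 P2 P : mfd d.+1) (D : dsum Y1 Y2 Y)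
      (E : dsum P1 P2 P) (h1 : homeo P1 (prodI Y1)) (h2 : homeo P2 (prodI Y2))
      (h : homeo P (prodI Y)),
    (forall p, prX (h (dl E p)) = dl D (prX (h1 p)) /\
               prT (h (dl E p)) = prT (h1 p)) ->
    (forall p, prX (h (dr E p)) = dr D (prX (h2 p)) /\
               prT (h (dr E p)) = prT (h2 p)) ->
    forall (c1 : fld F Y1) (c2 : fld F Y2),
    timesI h (dju D c1 c2) = dju E (timesI h1 c1) (timesI h2 c2);
  timesI_glued : forall d, (d.+1 <= n)%N ->
    forall (Y Ygl : mfd d.+1) (P Pgl : mfd d.+2) (G : gluing Y Ygl)
      (G' : gluing P Pgl) (h : homeo P (prodI Y)) (hgl : homeo Pgl (prodI Ygl))
      (hY : homeo (gY G') (prodI (gY G))),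
    (forall p, prX (hgl (gq G' p)) = gq G (prX (h p)) /\
               prT (hgl (gq G' p)) = prT (h p)) ->
    (forall t, prX (h (incl (gj1 G' t))) = incl (gj1 G (prX (hY t))) /\
               prT (h (incl (gj1 G' t))) = prT (hY t)) ->
    (forall t, prX (h (incl (gj2 G' t))) = incl (gj2 G (prX (hY t))) /\
               prT (h (incl (gj2 G' t))) = prT (hY t)) ->
    forall (c : fld F Y) (c' : fld F Ygl),
    glued G c c' -> glued G' (timesI h c) (timesI hgl c');
  (* bd(Y x I) is (Y x 0 + Y x 1) + bdY x I glued along the boundaries *)
  timesI_res : forall d, (d.+1 <= n)%N ->
    forall (Y : mfd d.+1) (P : mfd d.+2) (Q T1 T : mfd d.+1)
      (h : homeo P (prodI Y)) (hQ : homeo Q (prodI (bdy Y)))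
      (D1 : dsum Y Y T1) (D : dsum T1 Q T) (G : gluing T (bdy P)),
    (forall y, prX (h (incl (gq G (dl D (dl D1 y))))) = y /\
               prT (h (incl (gq G (dl D (dl D1 y))))) = 0) ->
    (forall y, prX (h (incl (gq G (dl D (dr D1 y))))) = y /\
               prT (h (incl (gq G (dl D (dr D1 y))))) = 1) ->
    (forall p, prX (h (incl (gq G (dr D p)))) = incl (prX (hQ p)) /\
               prT (h (incl (gq G (dr D p)))) = prT (hQ p)) ->
    (forall t, exists p, incl (gj1 G t) = dl D p) ->
    (forall t, exists q, incl (gj2 G t) = dr D q) ->
    forall c : fld F Y,
    glued G (dju D (dju D1 c c) (timesI hQ (res c))) (res (timesI h c)) }.

Record fields := Fields { fdata :> field_data R K n; fieldsP : is_fields fdata }.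

(** * Local relations *)

(* Only the values of [lr] at n-balls matter; U(B; c) is the set of all u in
   F(B; c) satisfying [lr u].  In [lr_ideal], the decomposition of B into B'
   and B'' is allowed to involve several gluings, some of them gluing B' to
   itself. *)
Record local_relations (F : fields) := LocalRelations {
  lr : forall B : mfd n.+1, fld F B -> Prop;
  lr_zero : forall B : mfd n.+1, is_ball B -> forall c : fld F (bdy B),
    lr (vec (0 : vs c));
  lr_lin : forall B : mfd n.+1, is_ball B ->
    forall a (c : fld F (bdy B)) (u v : vs c),
    lr (vec u) -> lr (vec v) -> lr (vec (a *: u + v));
  lr_act : forall B B' : mfd n.+1, is_ball B -> is_ball B' ->
    forall (f : homeo B B') (x : fld F B), lr x <-> lr (act f x);
  lr_isotopy : forall B : mfd n.+1, is_ball B ->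
    forall (c : fld F (bdy B)) (u v : vs c),
    ext_isotopic (vec u) (vec v) -> lr (vec (u - v));
  lr_ideal : forall (B B' B'' M : mfd n.+1) (D : dsum B' B'' M) (s : decomp B M),
    is_ball B -> is_ball B' ->
    forall (x : fld F B') (r : fld F B'') (b : fld F B),
    lr x -> total_glued F s (dju D x r) b -> lr b }.

End Fields.

(** * Quotients of vector spaces *)

Section LmodQuotient.
Local Open Scope quotient_scope.
Variables (K : fieldType) (V : lmodType K) (A : set V).

Inductive in_span : V -> Prop :=
| in_span0 : in_span 0
| in_spanP a x y : A x -> in_span y -> in_span (a *: x + y).

Lemma in_spanD x y : in_span x -> in_span y -> in_span (x + y).
Proof.
move=> hx hy; elim: hx => [|a u v Au _ IH]; first by rewrite add0r.
by rewrite -addrA; exact: in_spanP.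
Qed.

Lemma in_spanZ a x : in_span x -> in_span (a *: x).
Proof.
elim=> [|b u v Au _ IH]; first by rewrite scaler0; exact: in_span0.
by rewrite scalerDr scalerA; exact: in_spanP.
Qed.

Definition spanp : {pred V} := fun x => `[< in_span x >].

Lemma spanp_zmod_closed : zmod_closed spanp.
Proof.
split=> [|x y /asboolP hx /asboolP hy]; apply/asboolP; first exact: in_span0.
by apply: in_spanD => //; rewrite -scaleN1r; exact: in_spanZ.
Qed.

HB.instance Definition _ := GRing.isZmodClosed.Build V spanp spanp_zmod_closed.

(* V modulo the subspace spanned by A *)
Definition lquot := Quotient.quot (spanp : zmodClosed V).
HB.instance Definition _ := GRing.Zmodule.on lquot.
HB.instance Definition _ := EqQuotient.on lquot.

Definition lquot_pi (x : V) : lquot := \pi x.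

Definition lquot_scale (a : K) (x : lquot) : lquot := lquot_pi (a *: generic_quotient.repr x).

Lemma lquot_eq x y : in_span (x - y) -> lquot_pi x = lquot_pi y.
Proof.
move=> h; apply/eqP; rewrite /lquot_pi -(@Quotient.idealrBE V).
exact/asboolP.
Qed.

Lemma lquot_repr x : in_span (generic_quotient.repr (lquot_pi x) - x).
Proof.
suff /asboolP : generic_quotient.repr (lquot_pi x) - x \in (spanp : zmodClosed V) by [].
by rewrite Quotient.idealrBE; apply/eqP; exact: generic_quotient.reprK.
Qed.

Lemma lquot_piD x y : lquot_pi (x + y) = lquot_pi x + lquot_pi y.
Proof. by rewrite /lquot_pi (@pi_addr _ _ _ _ _ lquot). Qed.

Lemma lquot_piZ a x : lquot_pi (a *: x) = lquot_scale a (lquot_pi x).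
Proof.
apply: lquot_eq; rewrite -scalerBr -opprB -scaleN1r.
by do 2!apply: in_spanZ; exact: lquot_repr.
Qed.

Lemma lquot_surj x : exists y, x = lquot_pi y.
Proof.
by exists (generic_quotient.repr x); rewrite /lquot_pi generic_quotient.reprK.
Qed.

Lemma lquot_scaleA a b x :
  lquot_scale a (lquot_scale b x) = lquot_scale (a * b) x.
Proof. by have [y ->] := lquot_surj x; rewrite -!lquot_piZ scalerA. Qed.

Lemma lquot_scale1 : left_id 1 lquot_scale.
Proof. by move=> x; have [y ->] := lquot_surj x; rewrite -lquot_piZ scale1r. Qed.

Lemma lquot_scaleDr : right_distributive lquot_scale +%R.
Proof.
move=> a x y; have [u ->] := lquot_surj x; have [v ->] := lquot_surj y.
by rewrite -lquot_piD -!lquot_piZ -lquot_piD scalerDr.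
Qed.

Lemma lquot_scaleDl x : {morph lquot_scale^~ x : a b / a + b}.
Proof.
move=> a b; have [y ->] := lquot_surj x.
by rewrite -!lquot_piZ -lquot_piD scalerDl.
Qed.

HB.instance Definition _ := GRing.Zmodule_isLmodule.Build K lquot
  lquot_scaleA lquot_scale1 lquot_scaleDr lquot_scaleDl.

End LmodQuotient.

(** * The blob complex *)

Section Blobs.
Variables (R : realType) (K : fieldType) (n : nat) (F : fields R K n).
Variable U : local_relations F.
Local Notation mfd := (mfd R).

(* An n-manifold with a boundary condition; if the boundary is empty there is
   exactly one boundary condition. *)
Record bmfd := Bmfd { bX :> mfd n.+1; bc : fld F (bdy bX) }.

(* Homeomorphisms carrying boundary conditions along. *)
Definition bhomeo (A B : bmfd) : Type :=
  {f : homeo A B | exists2 g, restricts f g & act g (bc A) = bc B}.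

(* U(B) (x) F(W) inside F(L), where L is the disjoint union of B and W: the
   fields on L whose restriction to B lies in U(B). *)
Inductive in_U (B W L : mfd n.+1) (D : dsum B W L) : fld F L -> Prop :=
| in_U_dju u w : lr U u -> in_U D (dju D u w)
| in_U_lin a x y z : in_U D x -> in_U D y -> lincomb F a x y z -> in_U D z.

Definition twig (X : Type) k (B : 'I_k -> set X) (i : 'I_k) : Prop :=
  forall j, ~ (B j `<` B i).

(* A gluing decomposition of [X] compatible with [B], with a choice for each i
   of a connected component [ccomp i] of some stage which is a ball and whose
   image in [X] is [B i]; [crest i] is the complement of that component. *)
Record compatible (X : mfd n.+1) k (B : 'I_k -> set X) := Compatible {
  cM : mfd n.+1;
  cdec : decomp X cM;
  clev : 'I_k -> nat;
  ccomp : 'I_k -> mfd n.+1;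
  crest : 'I_k -> mfd n.+1;
  cdsum : forall i, dsum (ccomp i) (crest i) (stage cdec (clev i));
  ccomp_conn : forall i, connected (car (ccomp i));
  ccomp_ball : forall i, is_ball (ccomp i);
  ccomp_image : forall i,
    B i = [set stage_map cdec (clev i) (dl (cdsum i) p) | p in setT] }.

(* The field [r] on [X] is obtained by gluing from [x], and its restriction to
   each twig blob is in U. *)
Definition blob_field (X : mfd n.+1) k (B : 'I_k -> set X) (C : compatible B)
    (x : fld F (cM C)) (r : fld F X) : Prop :=
  total_glued F (cdec C) x r /\
  forall i, twig B i -> forall y,
    stage_glued F (cdec C) (clev C i) x y -> in_U (cdsum C i) y.

(* k-blob diagrams on [A], with its boundary condition. *)
Record diagram (A : bmfd) k := Diagram {
  blobs : 'I_k -> set (A : Type);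
  field : fld F A;
  field_bc : res field = bc A;
  diagramP : exists (C : compatible blobs) (x : fld F (cM C)), blob_field x field }.

Definition gen (A : bmfd) k (s : diagram A k) : {freeg {classic diagram A k} / K} :=
  << (s : {classic diagram A k}) >>.

(* For a given configuration, a given compatible decomposition and given
   values of the field along the cuts, diagrams form a vector space, of which
   [rel_lin] retains the linear structure.  Diagrams with different values
   along the cuts remain independent, as in the direct sum over c of the
   U(B; c) (x) F(X \ B; c) in the case of one blob. *)
Inductive blob_rel (A : bmfd) k : set {freeg {classic diagram A k} / K} :=
| rel_lin (B : 'I_k -> set (A : Type)) (C : compatible B)
    (a : K) (x y z : fld F (cM C)) (s t u : diagram A k) :
    blobs s = B -> blobs t = B -> blobs u = B ->
    blob_field x (field s) -> blob_field y (field t) -> blob_field z (field u) ->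
    lincomb F a x y z ->
    blob_rel (gen u - (a *: gen s + gen t))
| rel_perm (sigma : 'S_k) (s t : diagram A k) :
    field t = field s -> blobs t = (fun i => blobs s (sigma i)) ->
    blob_rel (gen t - (-1) ^+ sigma *: gen s).

Definition blob (A : bmfd) k : lmodType K := lquot (@blob_rel A k).

Definition blob_class (A : bmfd) k (s : diagram A k) : blob A k :=
  lquot_pi (@blob_rel A k) (gen s).

(* [t] is obtained from [s] by forgetting the i-th blob. *)
Definition forgets (A : bmfd) k (i : 'I_k.+1) (s : diagram A k.+1)
    (t : diagram A k) : Prop :=
  field t = field s /\ forall j, blobs t j = blobs s (fintype.lift i j).

(* [t] is the image of [s] under [f]. *)
Definition transports (A B : bmfd) (f : homeo A B) k (s : diagram A k)
    (t : diagram B k) : Prop :=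
  field t = act f (field s) /\ forall i, blobs t i = f @` blobs s i.

End Blobs.

Arguments blob_class {R K n F} U {A k} s.

(** * Categories *)

Record category := Category {
  obj :> Type;
  mor : obj -> obj -> Type;
  idm : forall a, mor a a;
  cmp : forall a b c, mor b c -> mor a b -> mor a c;
  cmp1m : forall a b (f : mor a b), cmp (idm b) f = f;
  cmpm1 : forall a b (f : mor a b), cmp f (idm a) = f;
  cmpA : forall a b c d (h : mor c d) (g : mor b c) (f : mor a b),
    cmp h (cmp g f) = cmp (cmp h g) f }.

(* Functors with object part [Phi]. *)
Record functor_on (C D : category) (Phi : C -> D) := FunctorOn {
  fmor : forall a b : C, mor a b -> mor (Phi a) (Phi b);
  fmor_id : forall a, fmor (idm a) = idm (Phi a);
  fmor_cmp : forall (a b c : C) (g : mor b c) (f : mor a b),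
    fmor (cmp g f) = cmp (fmor g) (fmor f) }.

Section ChainComplexes.
Variable K : fieldType.

Record complex := Complex {
  chain : nat -> lmodType K;
  dif : forall k, {linear chain k.+1 -> chain k};
  dif_dif : forall k x, dif k (dif k.+1 x) = 0 }.

Record chain_iso (C D : complex) := ChainIso {
  cmap :> forall k, chain C k -> chain D k;
  cmap_lin : forall k, linear (@cmap k);
  cmap_bij : forall k, bijective (@cmap k);
  cmap_diff : forall k x, cmap (dif C k x) = dif D k (cmap x) }.

Lemma chain_iso_eq C D (f g : chain_iso C D) :
  (forall k, @cmap _ _ f k =1 @cmap _ _ g k) -> f = g.
Proof.
case: f g => [f fl fb fd] [g gl gb gd] /= e.
have e1 : f = g by apply: functional_extensionality_dep => k; apply/funext.
by subst g; congr ChainIso; exact: Prop_irrelevance.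
Qed.

Definition chain_iso_id C : chain_iso C C.
Proof.
exists (fun k x => x) => //.
by move=> k; exists id.
Defined.

Definition chain_iso_comp C D E (g : chain_iso D E) (f : chain_iso C D) :
  chain_iso C E.
Proof.
exists (fun k => @cmap _ _ g k \o @cmap _ _ f k).
- by move=> k a x y /=; rewrite cmap_lin cmap_lin.
- by move=> k; apply: bij_comp; exact: cmap_bij.
- by move=> k x /=; rewrite !cmap_diff.
Defined.

Definition complexes : category.
Proof.
refine (@Category complex chain_iso chain_iso_id chain_iso_comp _ _ _);
  by move=> *; exact: chain_iso_eq.
Defined.

End ChainComplexes.

Section ManifoldCategory.
Variables (R : realType) (K : fieldType) (n : nat) (F : fields R K n).

Lemma bhomeo_eq (A B : bmfd F) (f g : bhomeo A B) : sval f =1 sval g -> f = g.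
Proof.
case: f g => [f hf] [g hg] /= e; have e' := homeo_eq e.
by subst g; congr exist; exact: Prop_irrelevance.
Qed.

Definition bhomeo_id (A : bmfd F) : bhomeo A A.
Proof.
exists (homeo_id A); exists (homeo_id (bdy A)) => //.
by apply: (act_id (fieldsP F)).
Defined.

Definition bhomeo_comp (A B C : bmfd F) (g : bhomeo B C) (f : bhomeo A B) :
  bhomeo A C.
Proof.
exists (homeo_comp (sval g) (sval f)).
case: f g => [f [f' rf ef]] [g [g' rg eg]] /=.
exists (homeo_comp g' f'); first by move=> p /=; rewrite rg rf.
by rewrite (act_comp (fieldsP F)) // ef.
Defined.

(* n-manifolds (with boundary conditions) and homeomorphisms. *)
Definition manifolds : category.
Proof.
refine (@Category (bmfd F) (@bhomeo _ _ _ F) bhomeo_id bhomeo_comp _ _ _);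
  by move=> *; exact: bhomeo_eq.
Defined.

End ManifoldCategory.

(* Main.v *)
From HB Require Import structures.
From mathcomp Require Import all_boot all_order all_algebra all_fingroup.
From mathcomp Require Import all_classical all_reals all_analysis.
From mathcomp Require Import lra zify.
From mathcomp.multinomials Require Import freeg.
Require Import Defs.

Set Implicit Arguments.
Unset Strict Implicit.
Unset Printing Implicit Defensive.
Import Order.TTheory GRing.Theory Num.Theory numFieldNormedType.Exports.
Local Open Scope classical_set_scope.
Local Open Scope ring_scope.

(** A homeomorphism carries fields, gluing decompositions and local relations
    along, so that diagrams can be pushed forward ([push]) and the maps induced
    on spaces of diagrams satisfy every identity that holds for diagrams.  What
    has to be proved is that the differential exists: forgetting a blob of a
    diagram must yield a diagram ([blob_field_forget]).  The case of interest is
    that of a twig blob Bi contained in a blob Bj that becomes a twig when Bi is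
    forgotten.  The restriction of the field to Bi is known to lie in U(Bi), and its
    restriction to Bj has to lie in U(Bj).  This is the ideal property of local
    relations, provided that Bj is glued from Bi and a complement of it
    ([in_U_nested]).

    Blobs are only given as images of components of stages of a gluing
    decomposition.  Gluing identifies boundary points only, so an inner point is
    alone in its fibre over the glued manifold ([total_map_fiber]); together
    with connectedness this shows that Bi belongs to an earlier stage than Bj,
    and that the gluings between the two stages map Bi into Bj
    ([nested_stages]).  These gluings restrict to the part of the earlier stage
    that becomes Bj ([decomp_split]), and this part is the disjoint union of Bi
    and some other manifold.

    On the side of fields, a field on the earlier stage whose restriction to Bi
    is in U is a linear combination of fields u * a * r, with u in U(Bi), with a
    on the rest of the part that becomes Bj, and with r outside of it: this is
    the tensor product property of disjoint unions ([dju_span]).  All terms have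
    the same boundary condition, so each of them can be glued when their
    combination can.  It remains to see that u * a can be glued separately from
    r.  A field can be glued if its boundary condition is itself glued from
    matching pieces, and in lower dimension fields on a disjoint union are pairs
    of fields; so a disjoint union that can be glued has summands that can be
    glued, by induction on the dimension ([glued_split]).

    The restriction of gluings to summands rests on two facts of PL topology:
    the inverse of a PL embedding is PL ([pl_lift]), and a clopen part of a
    manifold is a manifold, whose boundary is the corresponding part of the
    boundary ([clopen_mfd]).

    The rest is multilinear algebra.  The alternating sum of the diagrams with
    one blob forgotten respects the relations among diagrams, permutations of
    blobs being accounted for by the sign of a permutation with one point
    removed ([bd_class_respects]), and its square vanishes because blobs can be
    forgotten in any order ([forget_forget]). *)

(** * Polyhedra and piecewise linear maps *)

Section Polyhedra.
Variable R : realType.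
Local Notation space := (Defs.space R).

Lemma in_cell_cat N (Q Q' : cell R N) x :
  in_cell (Q ++ Q') x <-> in_cell Q x /\ in_cell Q' x.
Proof.
split=> [h|[h h'] k]; last by rewrite mem_cat => /orP[/h|/h'].
by split=> k hk; apply: h; rewrite mem_cat hk ?orbT.
Qed.

Definition cell_pull N N' (M : 'M[R]_(N, N')) (b : 'rV[R]_N') (Q : cell R N') :
  cell R N := [seq (M *m h.1, h.2 - (b *m h.1) 0 0) | h <- Q].

Lemma in_cell_pull N N' (M : 'M[R]_(N, N')) b Q x :
  in_cell (cell_pull M b Q) x <-> in_cell Q (x *m M + b).
Proof.
have key (h : 'cV[R]_N' * R) : ((x *m (M *m h.1)) 0 0 <= h.2 - (b *m h.1) 0 0) =
    (((x *m M + b) *m h.1) 0 0 <= h.2).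
  by rewrite mulmxDl -mulmxA [in RHS]mxE lerBrDr.
split=> [H h hQ|H _ /mapP[h hQ ->]]; last by rewrite key; exact: H.
by rewrite -key; apply: (H (M *m h.1, h.2 - (b *m h.1) 0 0)); apply/mapP; exists h.
Qed.

Lemma polyhedron0 N : polyhedron (set0 : set 'rV[R]_N).
Proof. by exists [::]; apply/esym; rewrite -subset0 => x [Q]. Qed.

Lemma polyhedronU N (A B : set 'rV[R]_N) :
  polyhedron A -> polyhedron B -> polyhedron (A `|` B).
Proof.
move=> [s ->] [t ->]; exists (s ++ t); rewrite predeqE => x; split.
  by case=> -[Q hQ hx]; exists Q => //; rewrite mem_cat hQ ?orbT.
by case=> Q; rewrite mem_cat => /orP[] hQ hx; [left|right]; exists Q.
Qed.

Lemma polyhedronI N (A B : set 'rV[R]_N) :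
  polyhedron A -> polyhedron B -> polyhedron (A `&` B).
Proof.
move=> [s ->] [t ->]; exists [seq Q ++ Q' | Q <- s, Q' <- t].
rewrite predeqE => x; split.
  case=> -[Q hQ hx] [Q' hQ' hx']; exists (Q ++ Q'); last exact/in_cell_cat.
  by apply/allpairsP; exists (Q, Q').
case=> _ /allpairsP[[Q Q'] /= [hQ hQ' ->]] /in_cell_cat[hx hx'].
by split; [exists Q|exists Q'].
Qed.

Lemma polyhedron_big N (T : eqType) (s : seq T) (A : T -> set 'rV[R]_N) :
  (forall p, p \in s -> polyhedron (A p)) ->
  polyhedron [set x | exists2 p, p \in s & A p x].
Proof.
elim: s => [|p s IH] h.
  suff -> : [set x | exists2 p, p \in [::] & A p x] = set0 by exact: polyhedron0.
  by rewrite -subset0 => x [].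
have -> : [set x | exists2 q, q \in p :: s & A q x] =
    A p `|` [set x | exists2 q, q \in s & A q x].
  rewrite predeqE => x; split=> [[q]|[hx|[q qs hx]]].
  - by rewrite inE => /orP[/eqP-> ?|qs hx]; [left|right; exists q].
  - by exists p => //; rewrite mem_head.
  - by exists q => //; rewrite inE qs orbT.
apply: polyhedronU; first by apply: h; rewrite mem_head.
by apply: IH => q qs; apply: h; rewrite inE qs orbT.
Qed.

Lemma polyhedron_cell N (Q : cell R N) : polyhedron [set x | in_cell Q x].
Proof.
exists [:: Q]; rewrite predeqE => x; split=> [h|[Q']]; first by exists Q; rewrite ?mem_head.
by rewrite inE => /eqP ->.
Qed.

Lemma polyhedron_affine N N' (M : 'M[R]_(N, N')) b (A : set 'rV[R]_N') :
  polyhedron A -> polyhedron [set x | A (x *m M + b)].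
Proof.
move=> [s ->].
have -> : [set x | [set y | exists2 Q, Q \in s & in_cell Q y] (x *m M + b)] =
    [set x | exists2 Q, Q \in s & in_cell (cell_pull M b Q) x].
  by rewrite predeqE => x; split=> -[Q hQ /in_cell_pull hx]; exists Q.
by apply: (polyhedron_big (s := s)) => Q _; exact: polyhedron_cell.
Qed.

Lemma continuous_linear N (h : 'cV[R]_N) :
  continuous (fun x : 'rV[R]_N => (x *m h) 0 0).
Proof.
move=> x; rewrite (_ : (fun _ => _) = fun y : 'rV[R]_N => \sum_k y 0 k * h k 0).
  apply: cvg_big; first exact: add_continuous.
  exact: nbhs_filter.
  move=> k _; apply: (@cvgM _ _ _ _ (fun y : 'rV[R]_N => y 0 k) (fun=> h k 0)).
  - exact: nbhs_filter.
  - exact: (@coord_continuous _ _ _ 0 k x).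
  - by apply: cvg_cst; exact: nbhs_filter.
by apply/funext => y; rewrite mxE.
Qed.

Lemma closed_cell N (Q : cell R N) : closed [set x | in_cell Q x].
Proof.
have -> : [set x | in_cell Q x] =
    \bigcap_(h in [set h | h \in Q]) [set x : 'rV[R]_N | (x *m h.1) 0 0 <= h.2].
  by rewrite predeqE => x; split.
apply: closed_bigI => h _.
apply: (@closed_comp _ _ (fun x : 'rV[R]_N => (x *m h.1) 0 0) [set y | y <= h.2]).
  by move=> x _; exact: continuous_linear.
exact: closed_le.
Qed.

Lemma polyhedron_closed N (A : set 'rV[R]_N) : polyhedron A -> closed A.
Proof.
move=> [s ->]; elim: s => [|Q s IH].
  suff -> : [set x | exists2 p, p \in [::] & in_cell p x] = set0 :> set 'rV[R]_N.
    exact: closed0.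
  by rewrite -subset0 => x [].
have -> : [set x | exists2 q, q \in Q :: s & in_cell q x] =
    [set x | in_cell Q x] `|` [set x | exists2 q, q \in s & in_cell q x].
  rewrite predeqE => x; split=> [[q]|[hx|[q qs hx]]].
  - by rewrite inE => /orP[/eqP-> ?|qs hx]; [left|right; exists q].
  - by exists Q => //; rewrite mem_head.
  - by exists q => //; rewrite inE qs orbT.
by apply: closedU => //; exact: closed_cell.
Qed.

Lemma near_seq (T : topologicalType) (E : eqType) (s : seq E) (p : T)
    (P : E -> T -> Prop) :
  (forall e, e \in s -> \forall x \near p, P e x) ->
  \forall x \near p, forall e, e \in s -> P e x.
Proof.
elim: s => [|e s IH] h; first by apply: filterE => x e.
have h1 : \forall x \near p, P e x by apply: h; rewrite mem_head.
have h2 : \forall x \near p, forall e', e' \in s -> P e' x.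
  by apply: IH => e' hs; apply: h; rewrite inE hs orbT.
near=> x => e'; rewrite inE => /orP[/eqP ->|].
  by near: x.
by move: e'; near: x.
Unshelve. all: by end_near.
Qed.

Lemma continuous_affine N N' (M : 'M[R]_(N, N')) (b : 'rV[R]_N') :
  continuous (fun x : 'rV[R]_N => x *m M + b).
Proof.
move=> x A /nbhs_ballP[e e0 he].
suff : \forall y \near x, A (y *m M + b) by [].
have h : \forall y \near x, forall j, j \in enum 'I_N' ->
    ball ((x *m M + b) 0 j) e ((y *m M + b) 0 j).
  apply: near_seq => j _.
  have := @continuous_linear _ (col j M) x.
  move=> /cvgrPdist_lt /(_ e e0) hc; near=> y.
  have hy : `|(x *m col j M) 0 0 - (y *m col j M) 0 0| < e by near: y.
  rewrite -ball_normE /ball_ /= !mxE opprD addrACA subrr addr0.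
  by move: hy; rewrite !mxE; under eq_bigr do rewrite mxE;
     under [X in _ - X]eq_bigr do rewrite mxE.
near=> y; apply: he; split=> // i j; rewrite ord1.
have hy : forall j, j \in enum 'I_N' -> ball ((x *m M + b) 0 j) e ((y *m M + b) 0 j).
  by near: y.
by apply: hy; rewrite mem_enum.
Unshelve. all: by end_near.
Qed.

Lemma pl_continuous (X Y : space) (f : X -> Y) (p : X) (A : set 'rV[R]_(amb Y)) :
  pl f -> nbhs (sval (f p)) A ->
  \forall x \near sval p, forall x' : X, sval x' = x -> A (sval (f x')).
Proof.
move=> [s hs] hA.
have h : \forall x \near sval p, forall q, q \in s ->
    in_cell q.1 x -> A (x *m q.2.1 + q.2.2).
  apply: near_seq => q qs; have [hq|hq] := pselect (in_cell q.1 (sval p)).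
    have : nbhs (sval p *m q.2.1 + q.2.2) A by rewrite -(proj2 (hs p) q qs hq).
    by move=> /(@continuous_affine _ _ q.2.1 q.2.2) hh; near=> x => _; near: x; exact: hh.
  have : nbhs (sval p) (~` [set x | in_cell q.1 x]).
    apply: open_nbhs_nbhs; split=> //; rewrite openC; exact: closed_cell.
  by move=> hC; near=> x => hx; exfalso; move: hx; near: x.
near=> x => x' e.
have hx : forall q, q \in s -> in_cell q.1 x -> A (x *m q.2.1 + q.2.2) by near: x.
have [[q qs hq] hf] := hs x'; rewrite (hf q qs hq) e; apply: hx => //.
by rewrite -e.
Unshelve. all: by end_near.
Qed.

(** A piecewise linear map on a compact space is closed; near a point alone in
    its fibre it therefore has a continuous inverse. *)
Lemma pl_fiber_nbhs (X Z : space) (f : X -> Z) (p : X) (A : set 'rV[R]_(amb X)) :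
  compact (car X) -> pl f -> (forall x, f x = f p -> x = p) ->
  nbhs (sval p) A ->
  \forall z \near sval (f p), forall x : X, sval (f x) = z -> A (sval x).
Proof.
move=> cX [s hs] fib hA.
have h : \forall z \near sval (f p), forall q, q \in s ->
    forall x : X, in_cell q.1 (sval x) -> sval x *m q.2.1 + q.2.2 = z -> A (sval x).
  apply: near_seq => q qs.
  pose C := car X `&` ([set x | in_cell q.1 x] `&` ~` A°).
  have cC : compact C.
    apply: compact_closedI => //; apply: closedI; first exact: closed_cell.
    by rewrite closedC; exact: open_interior.
  pose g x : 'rV[R]_(amb Z) := x *m q.2.1 + q.2.2.
  have cI : closed (g @` C).
    apply: compact_closed; first exact: norm_hausdorff.
    apply: continuous_compact => //; apply: continuous_subspaceT.
    exact: continuous_affine.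
  have : nbhs (sval (f p)) (~` (g @` C)).
    apply: open_nbhs_nbhs; split; first by rewrite openC.
    move=> [x [hx [hq hA']] e]; apply: hA'.
    have e' : exist _ x hx = p.
      by apply: fib; apply: pt_inj; rewrite (proj2 (hs (exist _ x hx)) q qs hq).
    by move: hA; rewrite -e'.
  move=> hC; near=> z => x hq e; apply: contrapT => hx.
  have : (~` (g @` C)) z by near: z.
  apply; exists (sval x) => //; split; first exact: svalP.
  by split=> // /interior_subset.
near=> z => x e; have hz : forall q, q \in s -> forall x : X, in_cell q.1 (sval x) ->
    sval x *m q.2.1 + q.2.2 = z -> A (sval x) by near: z.
have [[q qs hq] hf] := hs x; apply: (hz q) => //.
by rewrite -(hf q qs hq).
Unshelve. all: by end_near.
Qed.

End Polyhedra.
Section Inverse.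
Variable R : realType.
Local Notation space := (Defs.space R).

(** An affine map injective on a nonempty convex set is injective on its affine
    span, since a small multiple of a vector of the span is a difference of two
    points of the set. *)
Lemma cell_left_inverse N N' (Q : cell R N) (M : 'M[R]_(N, N')) (b : 'rV[R]_N') :
  (forall x y, in_cell Q x -> in_cell Q y -> x *m M = y *m M -> x = y) ->
  exists Wc : 'M[R]_(N', N) * 'rV[R]_N, forall x, in_cell Q x ->
    (x *m M + b) *m Wc.1 + Wc.2 = x.
Proof.
move=> inj; have [[x0 hx0]|no] := pselect (exists x, in_cell Q x); last first.
  by exists (0, 0) => x hx; case: no; exists x.
pose P r := `[< exists2 B : 'M[R]_(r, N), row_free B
                  & forall k, in_cell Q (x0 + row k B) >].
have P0 : exists r, P r.
  exists 0%N; apply/asboolP; exists 0; last by case.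
  by rewrite /row_free mxrank0.
have Pb r : P r -> (r <= N)%N.
  by move=> /asboolP[B /eqP fB _]; rewrite -[X in (X <= _)%N]fB; exact: rank_leq_col.
have [r /asboolP[B fB hB] maxr] := ex_maxnP P0 Pb.
have spanB x : in_cell Q x -> (x - x0 <= B)%MS.
  move=> hx; apply: contrapT => /negP nB.
  have /maxr : P r.+1; last by rewrite ltnn.
  apply/asboolP; exists (col_mx (x - x0) B : 'M[R]_(1 + r, N)).
    rewrite /row_free eqn_leq rank_leq_row /= -{1}(eqP fB).
    have -> : \rank (col_mx (x - x0) B) = \rank (x - x0 + B)%MS by rewrite addsmxE.
    apply: rank_ltmx.
    rewrite ltmxE addsmxSr /=; apply: contra nB.
    by rewrite addsmx_sub => /andP[].
  suff h (k : 'I_(1 + r)) : in_cell Q (x0 + row k (col_mx (x - x0) B)) by exact: h.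
  case: (split_ordP k) => j ->; last by rewrite rowKd.
  by rewrite rowKu row_id addrC subrK.
have conv (p : 'rV[R]_r) : (forall k, 0 <= p 0 k) -> \sum_k p 0 k <= 1 ->
    in_cell Q (x0 + p *m B).
  move=> p0 p1 h hQ; rewrite mulmxDl mxE.
  have ha := hx0 h hQ; set a := (x0 *m h.1) 0 0 in ha *.
  have hb k : (row k B *m h.1) 0 0 <= h.2 - a.
    by have := hB k h hQ; rewrite mulmxDl mxE lerBrDl.
  have -> : (p *m B *m h.1) 0 0 = \sum_k p 0 k * (row k B *m h.1) 0 0.
    rewrite -mulmxA mxE; apply: eq_bigr => k _.
    by rewrite -row_mul [X in _ = _ * X]mxE.
  rewrite -lerBrDl; apply: le_trans (_ : \sum_k p 0 k * (h.2 - a) <= _).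
    by apply: ler_sum => k _; exact: ler_wpM2l.
  by rewrite -mulr_suml ler_piMl // subr_ge0.
have fBM : row_free (B *m M).
  apply: inj_row_free => u hu.
  pose S := \sum_k `|u 0 k|; have S0 : 0 <= S by apply: sumr_ge0.
  (* p - q = e *: u, and both are weights of convex combinations *)
  pose e := (1 + 2 * S)^-1.
  have e0 : 0 < e by rewrite invr_gt0; lra.
  pose q := \row_k (e * `|u 0 k|); pose p := \row_k (e * (`|u 0 k| + u 0 k)).
  have hq : in_cell Q (x0 + q *m B).
    apply: conv => [k|]; first by rewrite mxE mulr_ge0 // ltW.
    under eq_bigr do rewrite mxE.
    by rewrite -mulr_sumr -/S mulrC ler_pdivrMr; lra.
  have hp : in_cell Q (x0 + p *m B).
    apply: conv => [k|].
      rewrite mxE mulr_ge0 //; first exact: ltW.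
      by have := ler_norm (- u 0 k); rewrite normrN; lra.
    under eq_bigr do rewrite mxE.
    rewrite -mulr_sumr mulrC ler_pdivrMr; last lra.
    rewrite mul1r; apply: le_trans (_ : \sum_k (2 * `|u 0 k|) <= _).
      by apply: ler_sum => k _; have := ler_norm (u 0 k); lra.
    by rewrite -mulr_sumr -/S; lra.
  have pq : p = q + e *: u.
    by apply/rowP => k; rewrite !mxE mulrDr.
  have hz : e *: u *m B *m M = 0 by rewrite -!scalemxAl -mulmxA hu scaler0.
  have pqB : x0 + p *m B = x0 + q *m B + e *: u *m B by rewrite pq mulmxDl addrA.
  have e1 : x0 + q *m B + e *: u *m B = x0 + q *m B.
    by rewrite -pqB; apply: inj => //; rewrite pqB mulmxDl hz addr0.
  have /eqP : e *: u *m B = 0 by apply: (addrI (x0 + q *m B)); rewrite addr0.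
  rewrite -scalemxAl scaler_eq0 gt_eqF //= => /eqP uB; apply: (row_free_inj fB).
  by rewrite mul0mx.
exists (pinvmx (B *m M) *m B, x0 - (x0 *m M + b) *m (pinvmx (B *m M) *m B)) => x hx /=.
have /submxP[u hu] := spanB x hx.
have -> : x = x0 + u *m B by rewrite -hu addrC subrK.
have -> : (x0 + u *m B) *m M + b = x0 *m M + b + u *m B *m M by rewrite mulmxDl addrAC.
set W := pinvmx _ *m B; have eW : u *m B *m M *m W = u *m B.
  by rewrite -(mulmxA u B M) -(mulmxA u) (mulmxA (B *m M)) mulmxVp // mul1mx.
rewrite mulmxDl eW; set a := _ *m W.
by rewrite [a + _]addrC -addrA [a + _]addrC subrK addrC.
Qed.

Definition eq_cell N N' (A : 'M[R]_(N, N')) (d : 'rV[R]_N') : cell R N :=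
  [seq (col j A, - d 0 j) | j <- enum 'I_N'] ++
  [seq (- col j A, d 0 j) | j <- enum 'I_N'].

Lemma in_eq_cell N N' (A : 'M[R]_(N, N')) (d : 'rV[R]_N') x :
  in_cell (eq_cell A d) x <-> x *m A + d = 0.
Proof.
have key j : (x *m A + d) 0 j = (x *m col j A) 0 0 + d 0 j.
  by rewrite !mxE; congr (_ + _); apply: eq_bigr => k _; rewrite mxE.
split=> [h|h].
  apply/rowP => j; rewrite key [RHS]mxE; apply/eqP; rewrite eq_le; apply/andP; split.
    rewrite -lerBrDr sub0r; apply: (h (col j A, - d 0 j)).
    by rewrite mem_cat; apply/orP; left; apply/mapP; exists j; rewrite ?mem_enum.
  rewrite -lerBlDr sub0r lerNl.
  have := h (- col j A, d 0 j); rewrite /= mulmxN mxE; apply.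
  by rewrite mem_cat; apply/orP; right; apply/mapP; exists j; rewrite ?mem_enum.
have {}key j : (x *m col j A) 0 0 = - d 0 j.
  by apply/eqP; rewrite -addr_eq0 -key h mxE.
move=> k; rewrite mem_cat => /orP[] /mapP[j _ ->] /=; first by rewrite key.
by rewrite mulmxN mxE key opprK.
Qed.

(** On each piece of X the map f has an affine left inverse g; the piece of the
    inverse map consists of the y such that g y is in the given piece of X and
    f (g y) = y, which are again linear conditions. *)
Lemma embedding_inverse (X Y : space) (f : X -> Y) :
  polyhedron (car X) -> embedding f ->
  exists s : seq (cell R (amb Y) * ('M[R]_(amb Y, amb X) * 'rV[R]_(amb X))),
    (forall y, (exists x : X, sval (f x) = y) <-> exists2 p, p \in s & in_cell p.1 y) /\
    (forall x p, p \in s -> in_cell p.1 (sval (f x)) ->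
       sval x = sval (f x) *m p.2.1 + p.2.2).
Proof.
move=> [sX eX] [[sf hf] inj].
have XP x : car X x <-> exists2 Q, Q \in sX & in_cell Q x by rewrite eX.
pose piece : Type := (cell R (amb X) *
  (cell R (amb X) * ('M[R]_(amb X, amb Y) * 'rV[R]_(amb Y))))%type.
have inv (t : piece) : exists Wc : 'M[R]_(amb Y, amb X) * 'rV[R]_(amb X),
    t.1 \in sX -> t.2 \in sf -> forall x, in_cell (t.1 ++ t.2.1) x ->
      (x *m t.2.2.1 + t.2.2.2) *m Wc.1 + Wc.2 = x.
  have [h1|h1] := boolP (t.1 \in sX); last by exists (0, 0).
  have [h2|h2] := boolP (t.2 \in sf); last by exists (0, 0).
  suff inj' : forall x y, in_cell (t.1 ++ t.2.1) x -> in_cell (t.1 ++ t.2.1) y ->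
      x *m t.2.2.1 = y *m t.2.2.1 -> x = y.
    by have [Wc hWc] := cell_left_inverse t.2.2.2 inj'; exists Wc.
  move=> x y /in_cell_cat[hx hx'] /in_cell_cat[hy hy'] e.
  have cx : car X x by apply/XP; exists t.1.
  have cy : car X y by apply/XP; exists t.1.
  apply: (congr1 sval (inj (exist _ x cx) (exist _ y cy) _)); apply: pt_inj.
  by rewrite (proj2 (hf (exist _ x cx)) t.2 h2 hx')
             (proj2 (hf (exist _ y cy)) t.2 h2 hy') /= e.
have [w hw] := choice inv.
pose mk (Q : cell R (amb X)) p : cell R (amb Y) * _ := let Wc := w (Q, p) in
  (cell_pull Wc.1 Wc.2 (Q ++ p.1) ++
   eq_cell (Wc.1 *m p.2.1 - 1%:M) (Wc.2 *m p.2.1 + p.2.2), Wc).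
have mkP Q p y : Q \in sX -> p \in sf -> (in_cell (mk Q p).1 y <->
    in_cell (Q ++ p.1) (y *m (w (Q, p)).1 + (w (Q, p)).2) /\
    (y *m (w (Q, p)).1 + (w (Q, p)).2) *m p.2.1 + p.2.2 = y).
  move=> hQ hp; rewrite /mk in_cell_cat in_cell_pull in_eq_cell.
  rewrite mulmxBr mulmx1 mulmxDl -!mulmxA -addrA.
  split=> -[h1 h2]; split=> //.
    by apply/eqP; rewrite -subr_eq0 -h2; apply/eqP; rewrite [- y + _]addrC !addrA.
  by rewrite -{2}h2 [- _ + _]addrC !addrA; apply/eqP; rewrite subr_eq0.
exists [seq mk Q p | Q <- sX, p <- sf]; split=> [y|x _ /allpairsP[[Q p] /= [hQ hp ->]]].
  split=> [[x <-]|[_ /allpairsP[[Q p] /= [hQ hp ->]] /mkP []// h1 h2]].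
    have [Q hQ Qx] := (XP _).1 (svalP x); have [[p hp px] hfx] := hf x.
    exists (mk Q p); first by apply/allpairsP; exists (Q, p).
    have Cx : in_cell (Q ++ p.1) (sval x) by apply/in_cell_cat.
    have e := hfx p hp px; apply/mkP => //; rewrite e.
    by rewrite (hw (Q, p) hQ hp _ Cx).
  have /in_cell_cat[hq hq'] := h1.
  have cx : car X (y *m (w (Q, p)).1 + (w (Q, p)).2) by apply/XP; exists Q.
  by exists (exist _ _ cx); rewrite (proj2 (hf (exist _ _ cx)) p hp hq') /= h2.
move=> /mkP []// h1 h2; have /in_cell_cat[hq hq'] := h1.
have cx : car X (sval (f x) *m (w (Q, p)).1 + (w (Q, p)).2) by apply/XP; exists Q.
have e : f x = f (exist _ _ cx).
  by apply: pt_inj; rewrite (proj2 (hf (exist _ _ cx)) p hp hq') /= h2.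
by rewrite {1}(inj _ _ e).
Qed.

Lemma embedding_image (X Y : space) (f : X -> Y) :
  polyhedron (car X) -> embedding f ->
  polyhedron [set y | exists x : X, sval (f x) = y].
Proof.
move=> pX ef; have [s [hs _]] := embedding_inverse pX ef.
rewrite (_ : [set y | _] = [set y | exists2 p, p \in s & in_cell p.1 y]); last first.
  by rewrite predeqE.
by apply: polyhedron_big => p _; exact: polyhedron_cell.
Qed.

(** Maps into the image of a PL embedding lift to PL maps: the inverse of a PL
    embedding is PL. *)
Lemma pl_lift (X Y Z : space) (f : X -> Y) (h : Z -> Y) (g : Z -> X) :
  polyhedron (car X) -> embedding f -> pl h -> (forall z, f (g z) = h z) -> pl g.
Proof.
move=> pX ef [sh hh] fg; have [s [hs hs']] := embedding_inverse pX ef.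
pose I : space := @Space R (amb Y) [set y | exists x : X, sval (f x) = y].
have hI z : car I (sval (h z)) by exists (g z); rewrite fg.
have [k hk] := choice (fun y : I => svalP y : exists x : X, sval (f x) = sval y).
have pk : pl k.
  exists s => y; split; first by apply/hs; exact: (svalP y).
  by move=> p hp hy; rewrite -{1}hk; apply: hs' => //; rewrite hk.
have ph : pl (fun z => exist _ _ (hI z) : I) by exists sh.
have := pl_comp pk ph; congr (pl _); apply/funext => z /=.
apply: (proj2 ef); rewrite fg; apply: pt_inj.
exact: (hk (exist _ _ (hI z))).
Qed.

End Inverse.
(** * Charts, boundaries and clopen pieces *)

Section Charts.
Variable R : realType.
Local Notation space := (Defs.space R).
Local Notation mfd := (mfd R).

Lemma cube_compact k : compact (car (cube R k)).
Proof.
apply: (@rV_compact _ _ (fun=> [set x : R | 0 <= x <= 1])) => i.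
rewrite (_ : [set x | _] = `[0, 1]%classic); first exact: segment_compact.
by rewrite predeqE => x; rewrite /= in_itv.
Qed.

Lemma box_nbhs k (c : 'rV[R]_k) (A : set 'rV[R]_k) : nbhs c A ->
  exists2 e, 0 < e & forall y : 'rV[R]_k, (forall i, `|c 0 i - y 0 i| < e) -> A y.
Proof.
move=> /nbhs_ballP[e e0 he]; exists e => // y hy; apply: he; split=> // i j.
by rewrite ord1 -ball_normE; exact: hy.
Qed.

Lemma nbhs_box k (c : 'rV[R]_k) (P : 'I_k -> set R) :
  (forall i, nbhs (c 0 i) (P i)) -> nbhs c [set y | forall i, P i (y 0 i)].
Proof.
move=> h; have : nbhs c [set y | forall i, i \in enum 'I_k -> P i (y 0 i)].
  apply: (@near_seq _ _ (enum 'I_k) c (fun i y => P i (y 0 i))) => i _.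
  by apply: (@coord_continuous _ _ _ 0 i c); exact: h.
by apply: filterS => y hy i; apply: hy; rewrite mem_enum.
Qed.

Lemma strict_nbhs k (c : 'rV[R]_k) : (forall i, 0 < c 0 i < 1) ->
  nbhs c [set y | forall i, 0 < y 0 i < 1].
Proof.
move=> h; apply: (@nbhs_box k c (fun=> [set x | 0 < x < 1])) => i.
have /andP[h0 h1] := h i.
have e0 : 0 < Num.min (c 0 i) (1 - c 0 i) by rewrite lt_min h0 subr_gt0.
apply: filterS (nbhsx_ballx (c 0 i) _ e0) => x.
rewrite -ball_normE /ball_ /= lt_min !ltr_norml => /andP[/andP[a1 a2] /andP[a3 a4]].
by apply/andP; split; lra.
Qed.

Lemma chart_center k (X : space) (p : X) (phi : cube R k -> X) :
  chart p phi -> exists c, phi c = p.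
Proof.
move=> [_ /nbhs_singleton /(_ (svalP p))[c e]].
by exists c; exact: pt_inj.
Qed.

Section Rescale.
Variables (k : nat) (a b : 'rV[R]_k).
Hypothesis ab : forall i, [/\ 0 <= a 0 i, a 0 i < b 0 i & b 0 i <= 1].

Definition rescale_val (c : 'rV[R]_k) := c *m diag_mx (b - a) + a.

Lemma rescale_valE c i : rescale_val c 0 i = c 0 i * (b 0 i - a 0 i) + a 0 i.
Proof. by rewrite /rescale_val mul_mx_diag !mxE. Qed.

Lemma rescale_cube (c : cube R k) : car (cube R k) (rescale_val (sval c)).
Proof.
move=> i; rewrite rescale_valE; have := svalP c i; set t := sval c 0 i.
by have [h1 h2 h3] := ab i => /andP[t0 t1]; apply/andP; split; nra.
Qed.

Definition rescale (c : cube R k) : cube R k := exist _ _ (rescale_cube c).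

Lemma rescale_pl : pl rescale.
Proof.
exists [:: ([::], (diag_mx (b - a), a))] => x; split.
  by exists ([::], (diag_mx (b - a), a)); rewrite ?mem_head.
by move=> p; rewrite inE => /eqP ->.
Qed.

Lemma rescale_inj : injective rescale.
Proof.
move=> x y /(congr1 sval) /rowP e; apply: pt_inj; apply/rowP => i.
have := e i; rewrite !rescale_valE => /addIr; apply: mulIf.
by have [_ h _] := ab i; rewrite subr_eq0 gt_eqF.
Qed.

Lemma rescale_onto (c : cube R k) : (forall i, a 0 i <= sval c 0 i <= b 0 i) ->
  exists2 c', rescale c' = c &
    forall i, a 0 i < sval c 0 i < b 0 i -> 0 < sval c' 0 i < 1.
Proof.
move=> h; pose v : 'rV[R]_k := \row_i ((sval c 0 i - a 0 i) / (b 0 i - a 0 i)).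
have pos i : 0 < b 0 i - a 0 i by have [_ h' _] := ab i; rewrite subr_gt0.
have hv : car (cube R k) v.
  move=> i; rewrite mxE; have /andP[h1 h2] := h i; apply/andP; split.
    by rewrite divr_ge0 ?subr_ge0 // ltW // -subr_gt0.
  by rewrite ler_pdivrMr // mul1r lerB.
exists (exist _ v hv) => [|i /andP[h1 h2]].
  apply: pt_inj; apply/rowP => i; rewrite rescale_valE /= mxE divfK ?subrK //.
  by rewrite gt_eqF.
rewrite /= mxE; apply/andP; split.
  by apply: divr_gt0 => //; rewrite subr_gt0.
by rewrite ltr_pdivrMr // mul1r; lra.
Qed.
End Rescale.

(** A chart can be shrunk into any given neighbourhood, by rescaling the part of
    the cube close to the given point. *)
Lemma chart_shrink k (X : space) (p : X) (phi : cube R k -> X) c0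
    (A : set 'rV[R]_(amb X)) :
  chart p phi -> phi c0 = p -> nbhs (sval p) A ->
  exists psi : cube R k -> X,
    [/\ chart p psi, (forall c, A (sval (psi c))),
        (forall c, exists c', psi c = phi c')
      & exists2 c1, psi c1 = p &
          (forall i, 0 < sval c0 0 i < 1) -> forall i, 0 < sval c1 0 i < 1].
Proof.
move=> [[pphi iphi] nphi] e0 hA.
have : nbhs (sval (phi c0)) A by rewrite e0.
move=> /(pl_continuous pphi) /box_nbhs[d d0 hd].
pose e := d / 2; have ee : 0 < e by rewrite divr_gt0.
pose a : 'rV[R]_k := \row_i Num.max 0 (sval c0 0 i - e).
pose b : 'rV[R]_k := \row_i Num.min 1 (sval c0 0 i + e).
have c0P i : 0 <= sval c0 0 i <= 1 by exact: (svalP c0 i).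
have ab i : [/\ 0 <= a 0 i, a 0 i < b 0 i & b 0 i <= 1].
  have /andP[h1 h2] := c0P i; rewrite !mxE; split.
  - by rewrite le_max lexx.
  - by rewrite lt_min !gt_max ltr01 /=; apply/andP; split; [|apply/andP; split]; lra.
  - by rewrite ge_min lexx.
have near_c0 (c : cube R k) : (forall i, `|sval c0 0 i - sval c 0 i| < e) ->
    forall i, a 0 i <= sval c 0 i <= b 0 i.
  move=> h i; rewrite !mxE ge_max le_min; have /andP[-> ->] := svalP c i.
  have := h i; rewrite ltr_norml => /andP[h1 h2].
  by apply/andP; split; lra.
exists (phi \o rescale ab); split.
- split; first split.
  + by apply: pl_comp => //; exact: rescale_pl.
  + by move=> x y /= /iphi; exact: rescale_inj.
  have hn : nbhs (sval c0) [set c | forall i, `|sval c0 0 i - c 0 i| < e].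
    apply: (@nbhs_box k (sval c0) (fun i => [set x | `|sval c0 0 i - x| < e])) => i.
    by have := nbhsx_ballx (sval c0 0 i) e ee; rewrite -ball_normE.
  have fib c : phi c = phi c0 -> c = c0 by exact: iphi.
  have := pl_fiber_nbhs (cube_compact (k := k)) pphi fib hn; rewrite e0 => hn'.
  near=> y => Xy.
  have : car X y -> exists c, sval (phi c) = y by near: y.
  move=> /(_ Xy)[c hc].
  have : forall x, sval (phi x) = y ->
      [set c | forall i, `|sval c0 0 i - c 0 i| < e] (sval x) by near: y.
  move=> /(_ c hc) /near_c0 /(rescale_onto ab)[c' e' _].
  by exists c'; rewrite /= e'.
- move=> c; apply: (hd (sval (rescale ab c))) => // i /=.
  rewrite rescale_valE; have [h1 h2 h3] := ab i.
  have /andP[t0 t1] := svalP c i; set t := sval c 0 i in t0 t1 *.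
  have k1 : a 0 i >= sval c0 0 i - e by rewrite mxE le_max lexx orbT.
  have k2 : b 0 i <= sval c0 0 i + e by rewrite mxE ge_min lexx orbT.
  have ed : e + e = d by rewrite /e; lra.
  by rewrite ltr_norml; apply/andP; split; nra.
- by move=> c; exists (rescale ab c).
have [|c1 e1 h1] := @rescale_onto _ _ _ ab c0.
  by apply: near_c0 => i; rewrite subrr normr0.
exists c1; first by rewrite /= e1.
move=> h i; apply: h1; rewrite !mxE gt_max lt_min; have /andP[-> ->] := h i.
by apply/andP; split; lra.
Unshelve. all: by end_near.
Qed.

(** Shape of the neighbourhoods of f p: as f is closed and p is alone in its
    fibre, points close to f p come from points close to p only. *)
Lemma chart_push k (X Z : space) (f : X -> Z) (p : X) (phi : cube R k -> X) :
  compact (car X) -> pl f -> (forall x, f x = f p -> x = p) ->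
  (\forall z \near sval (f p), car Z z -> exists x, sval (f x) = z) ->
  chart p phi -> injective (f \o phi) -> chart (f p) (f \o phi).
Proof.
move=> cX pf fib img [[pphi iphi] nphi] inj; split; first by split=> //; exact: pl_comp.
have hn := pl_fiber_nbhs cX pf fib nphi.
near=> z => Zz.
have [x hx] : exists x, sval (f x) = z.
  by move: Zz; near: z.
have : forall x, sval (f x) = z -> car X (sval x) -> exists c, sval (phi c) = sval x.
  by near: z.
move=> /(_ x hx (svalP x))[c hc]; exists c => /=.
by rewrite (_ : phi c = x) //; exact: pt_inj.
Unshelve. all: by end_near.
Qed.

(** A chart at f p, shrunk into the image of f, lifts through f. *)
Lemma chart_pull k (X Z : space) (f : X -> Z) (p : X) (phi : cube R k -> Z) c0 :
  polyhedron (car X) -> embedding f ->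
  (\forall z \near sval (f p), car Z z -> exists x, sval (f x) = z) ->
  chart (f p) phi -> phi c0 = f p ->
  exists psi : cube R k -> X, chart p psi /\
    exists2 c1, psi c1 = p &
      (forall i, 0 < sval c0 0 i < 1) -> forall i, 0 < sval c1 0 i < 1.
Proof.
move=> pX ef img hphi e0.
have [psi [hpsi Apsi _ [c1 e1 h1]]] := chart_shrink hphi e0 img.
have lift c : exists x, f x = psi c.
  by have [x hx] := Apsi c (svalP _); exists x; exact: pt_inj.
have [g hg] := choice lift; exists g; split; last first.
  by exists c1 => //; apply: (proj2 ef); rewrite hg.
have [[ppsi ipsi] npsi] := hpsi.
split; first split.
- exact: (pl_lift pX ef ppsi hg).
- by move=> x y e; apply: ipsi; rewrite -!hg e.
have := pl_continuous (proj1 ef) npsi.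
apply: filterS => x hx Xx; have [c hc] := hx (exist _ x Xx) erefl (svalP _).
exists c; suff -> : g c = exist _ x Xx by [].
by apply: (proj2 ef); rewrite hg; exact: pt_inj.
Qed.

Lemma inner_embedding k (X Z : space) (f : X -> Z) (p : X) :
  polyhedron (car X) -> compact (car X) -> embedding f ->
  (\forall z \near sval (f p), car Z z -> exists x, sval (f x) = z) ->
  inner k (f p) <-> inner k p.
Proof.
move=> pX cX ef img; split=> -[phi [hphi [c0 e0 h0]]].
  have [psi [hpsi [c1 e1 h1]]] := chart_pull pX ef img hphi e0.
  by exists psi; split=> //; exists c1 => //; exact: h1.
exists (f \o phi); split; last by exists c0; rewrite //= e0.
apply: chart_push => //; first exact: (proj1 ef).
  by move=> x /(proj2 ef).
by apply: inj_comp; [exact: (proj2 ef)|exact: (proj2 (proj1 hphi))].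
Qed.

(** One chart serves for all points close enough to its centre. *)
Lemma near_inner k (X : space) (p : X) : inner k p ->
  \forall x \near sval p, forall x' : X, sval x' = x -> inner k x'.
Proof.
move=> [phi [[ephi nphi] [c0 e0 h0]]].
have fib c : phi c = phi c0 -> c = c0 by exact: (proj2 ephi).
have := pl_fiber_nbhs (cube_compact (k := k)) (proj1 ephi) fib (strict_nbhs h0).
rewrite e0 => hn; have nphi' := nbhs_interior nphi.
near=> x => x' e.
have [c hc] : exists c, sval (phi c) = x.
  have : car X x by rewrite -e; exact: svalP.
  by near: x.
have ec : phi c = x' by apply: pt_inj; rewrite e.
exists phi; split; last first.
  exists c => //; have : forall c, sval (phi c) = x -> forall i, 0 < sval c 0 i < 1.
    by near: x.
  by move=> /(_ c hc).
split=> //; rewrite e.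
have : [set y | car X y -> exists c, sval (phi c) = y]° x by near: x.
exact.
Unshelve. all: by end_near.
Qed.

Lemma mfd_polyhedron d (X : mfd d) : polyhedron (car X).
Proof. by case: d X => [|d] [X /=]; [move=> ->; exact: polyhedron0|case]. Qed.

Lemma mfd_compact d (X : mfd d) : compact (car X).
Proof. by case: d X => [|d] [X /=]; [move=> ->; exact: compact0|case]. Qed.

Definition onb d (X : mfd d) (p : X) : Prop := exists b : bdy X, incl b = p.

Lemma onbE d (X : mfd d) (p : X) : onb p <-> ~ inner d.-1 p.
Proof.
split=> [[[x [q [e hq]]] <-]|hp].
  suff -> : incl (exist _ x (ex_intro _ q (conj e hq)) : bdy X) = q by [].
  by apply: pt_inj; rewrite /= e.
have hb : car (bdy X) (sval p) by exists p.
by exists (exist _ _ hb); exact: pt_inj.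
Qed.

Lemma incl_inj d (X : mfd d) : injective (@incl R d X).
Proof. by move=> x y /(congr1 sval) e; exact: pt_inj. Qed.

Lemma inclusion_embedding (X : space) (A : set 'rV[R]_(amb X))
    (f : @Space R (amb X) A -> X) :
  (forall x, sval (f x) = sval x) -> embedding f.
Proof.
move=> ef; split; last by move=> x y /(congr1 sval); rewrite !ef => e; exact: pt_inj.
exists [:: ([::], (1%:M, 0))] => x; split.
  by exists ([::], (1%:M, 0)); rewrite ?mem_head.
by move=> p; rewrite inE => /eqP -> _ /=; rewrite mulmx1 addr0.
Qed.

Lemma incl_embedding d (X : mfd d) : embedding (@incl R d X).
Proof. exact: inclusion_embedding. Qed.

Lemma embedding_comp (X Y Z : space) (g : Y -> Z) (f : X -> Y) :
  embedding g -> embedding f -> embedding (g \o f).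
Proof. by move=> [pg ig] [pf jf]; split; [exact: pl_comp|exact: inj_comp]. Qed.

(** By induction on the dimension: whether a point is inner is decided near it,
    so the boundary of the clopen piece cut out by P is the piece of the boundary
    cut out by P. *)
Lemma clopen_mfd d (X : space) (P P' : set 'rV[R]_(amb X)) :
  polyhedron P -> polyhedron P' ->
  (forall x, car X x -> P x \/ P' x) -> (forall x, car X x -> P x -> ~ P' x) ->
  is_mfd d X -> is_mfd d (@Space R (amb X) (car X `&` P)).
Proof.
move=> pP pP'; elim: d X P P' pP pP' => [|d IH] X P P' pP pP' cov dis /=.
  by move=> ->; rewrite set0I.
case=> pX cX chX bX; set S := Space _.
have pS : polyhedron (car S) by exact: polyhedronI.
have cS : compact (car S) by apply: compact_closedI => //; exact: polyhedron_closed.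
pose f (x : S) : X := exist _ (sval x) (proj1 (svalP x)).
have ef : embedding f by exact: inclusion_embedding.
have img p : \forall z \near sval (f p), car X z -> exists x, sval (f x) = z.
  have : nbhs (sval (f p)) (~` P').
    apply: open_nbhs_nbhs; split; first by rewrite openC; exact: polyhedron_closed.
    by apply: dis; [exact: svalP|exact: (proj2 (svalP p))].
  apply: filterS => z hz Xz.
  have Sz : car S z by split=> //; case: (cov z Xz).
  by exists (exist _ z Sz).
split=> //.
  move=> p; have [phi hphi] := chX (f p); have [c0 e0] := chart_center hphi.
  by have [psi [hpsi _]] := chart_pull pS ef (img p) hphi e0; exists psi.
have -> : bdspace d.+1 S = @Space R (amb X) (car (bdspace d.+1 X) `&` P).
  congr Space; rewrite predeqE => x; split.
    move=> [p [e hp]]; split; last by rewrite -e; exact: (proj2 (svalP p)).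
    exists (f p); split=> // hi; apply: hp.
    by apply/(inner_embedding d pS cS ef (img p)).
  move=> [[q [e hq]] Px].
  have Sx : car S x by split=> //; rewrite -e; exact: svalP.
  exists (exist _ x Sx); split=> // hi; apply: hq.
  rewrite (_ : q = f (exist _ x Sx)); last exact: pt_inj.
  by apply/(inner_embedding d pS cS ef (img _)).
have sub x : car (bdspace d.+1 X) x -> car X x by move=> [p [<- _]]; exact: svalP.
by apply: (IH (bdspace d.+1 X) P P') => // x /sub; [exact: cov|exact: dis].
Qed.

Lemma clopen_dsum d (X : mfd d) (P P' : set 'rV[R]_(amb X)) :
  polyhedron P -> polyhedron P' ->
  (forall x, car X x -> P x \/ P' x) -> (forall x, car X x -> P x -> ~ P' x) ->
  exists A B (D : dsum A B X),
    (forall x : X, P (sval x) <-> exists a, dl D a = x) /\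
    (forall x : X, P' (sval x) <-> exists b, dr D b = x).
Proof.
move=> pP pP' cov dis.
pose A := Mfd (clopen_mfd pP pP' cov dis (spP X)).
have cov' x : car X x -> P' x \/ P x by move/cov => [] ?; [right|left].
have dis' x : car X x -> P' x -> ~ P x by move=> Xx h h'; exact: (dis x).
pose B := Mfd (clopen_mfd pP' pP cov' dis' (spP X)).
pose f (x : A) : X := exist _ (sval x) (proj1 (svalP x)).
pose g (x : B) : X := exist _ (sval x) (proj1 (svalP x)).
have ef : embedding f by exact: inclusion_embedding.
have eg : embedding g by exact: inclusion_embedding.
have imf (x : X) : P (sval x) <-> exists a, f a = x.
  split=> [h|[a <-]]; last exact: (proj2 (svalP a)).
  by exists (exist _ (sval x) (conj (svalP x) h)); exact: pt_inj.
have img (x : X) : P' (sval x) <-> exists a, g a = x.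
  split=> [h|[a <-]]; last exact: (proj2 (svalP a)).
  by exists (exist _ (sval x) (conj (svalP x) h)); exact: pt_inj.
have disj a b : f a <> g b.
  move=> e; apply: (dis _ (svalP (f a))); first by apply/imf; exists a.
  by rewrite e; apply/img; exists b.
have cover z : (exists a, f a = z) \/ (exists b, g b = z).
  by case: (cov _ (svalP z)) => [/imf|/img]; [left|right].
by exists A, B, (Dsum ef eg disj cover).
Qed.

Definition dswap d (X W Z : mfd d) (D : dsum X W Z) : dsum W X Z.
Proof.
exists (dr D) (dl D); try by case: D.
- by move=> w x e; exact: (@dsum_disj _ _ _ _ _ D _ _ (esym e)).
- by move=> z; case: (dsum_cover D z); [right|left].
Defined.

Lemma dl_image d (A B Z : mfd d) (D : dsum A B Z) :
  polyhedron [set z | exists a, sval (dl D a) = z].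
Proof. by apply: embedding_image; [exact: mfd_polyhedron|exact: dl_emb]. Qed.

Lemma dl_near d (A B Z : mfd d) (D : dsum A B Z) a :
  \forall z \near sval (dl D a), car Z z -> exists a', sval (dl D a') = z.
Proof.
have : nbhs (sval (dl D a)) (~` [set z | exists b, sval (dr D b) = z]).
  apply: open_nbhs_nbhs; split.
    by rewrite openC; apply: polyhedron_closed; exact: (dl_image (dswap D)).
  by move=> [b /pt_inj e]; exact: (@dsum_disj _ _ _ _ _ D _ _ (esym e)).
apply: filterS => z hz Zz; have := dsum_cover D (exist _ z Zz).
by case=> -[a' e]; [exists a'; rewrite e|case: hz; exists a'; rewrite e].
Qed.

Lemma inner_dl k d (A B Z : mfd d) (D : dsum A B Z) a :
  inner k (dl D a) <-> inner k a.
Proof.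
apply: inner_embedding; [exact: mfd_polyhedron|exact: mfd_compact|exact: dl_emb|].
exact: dl_near.
Qed.

Lemma onb_dl d (A B Z : mfd d) (D : dsum A B Z) a : onb (dl D a) <-> onb a.
Proof. by rewrite !onbE inner_dl. Qed.

Lemma inner_gq d (X Xgl : mfd d) (G : gluing X Xgl) p p' :
  inner d.-1 p -> gq G p' = gq G p -> p' = p.
Proof.
move=> hp /gq_fib[//|[y [_ e]]|[y [_ e]]].
  by exfalso; move: hp; apply/onbE; rewrite e; eexists.
by exfalso; move: hp; apply/onbE; rewrite e; eexists.
Qed.

(** Gluing identifies boundary points only, so it is a homeomorphism near the
    others. *)
Lemma gq_inner d (X Xgl : mfd d) (G : gluing X Xgl) p :
  inner d.-1 p -> inner d.-1 (gq G p).
Proof.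
move=> hp; have [phi [hphi [c0 e0 h0]]] := hp.
have [psi [hpsi Apsi _ [c1 e1 h1]]] := chart_shrink hphi e0 (near_inner hp).
exists (gq G \o psi); split; last by exists c1; rewrite //= ?e1 //; exact: h1.
apply: chart_push => //; first exact: mfd_compact.
- exact: gq_pl.
- by move=> x; exact: inner_gq.
- by near=> z => Xz; have [x e] := gq_surj G (exist _ z Xz); exists x; rewrite e.
by move=> x y /= e; apply: (proj2 (proj1 hpsi)); apply: (inner_gq _ e); exact: Apsi.
Unshelve. all: by end_near.
Qed.

End Charts.
(** * Restriction of gluings to clopen pieces *)

Section Pieces.
Variable R : realType.
Local Notation space := (Defs.space R).
Local Notation mfd := (mfd R).

Lemma dl_inj d (A B X : mfd d) (D : dsum A B X) : injective (dl D).
Proof. exact: (proj2 (dl_emb D)). Qed.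

Lemma dr_inj d (A B X : mfd d) (D : dsum A B X) : injective (dr D).
Proof. exact: (proj2 (dr_emb D)). Qed.

Lemma dl_lift d (A B X : mfd d) (D : dsum A B X) (Y : space) (h : Y -> X) :
  pl h -> (forall y, exists a, dl D a = h y) ->
  exists g : Y -> A, pl g /\ forall y, dl D (g y) = h y.
Proof.
move=> ph /choice[g hg]; exists g; split=> //.
exact: (pl_lift (mfd_polyhedron A) (dl_emb D) ph hg).
Qed.

Lemma bd_embedding d (A B Z : mfd d) (D : dsum A B Z) :
  exists f : bdy A -> bdy Z, embedding f /\ forall p, incl (f p) = dl D (incl p).
Proof.
have h (p : bdy A) : exists b : bdy Z, incl b = dl D (incl p).
  by apply/onb_dl; exists p.
have [f hf] := choice h; exists f; split=> //; split.
  apply: (pl_lift (mfd_polyhedron (bdy Z)) (incl_embedding Z) _ hf).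
  by apply: pl_comp; [exact: (proj1 (dl_emb D))|exact: (proj1 (incl_embedding A))].
by move=> x y e; apply: (@incl_inj _ _ A); apply: (dl_inj (D := D)); rewrite -!hf e.
Qed.

Lemma bd_dsum d (A B Z : mfd d) (D : dsum A B Z) :
  exists D' : dsum (bdy A) (bdy B) (bdy Z),
    (forall p, incl (dl D' p) = dl D (incl p)) /\
    (forall p, incl (dr D' p) = dr D (incl p)).
Proof.
have [f [ef hf]] := bd_embedding D; have [g [eg hg]] := bd_embedding (dswap D).
have disj x w : f x <> g w.
  by move/(congr1 (fun b => incl b)); rewrite hf hg; exact: dsum_disj.
have cover z : (exists x, f x = z) \/ (exists w, g w = z).
  have hz : onb (incl z) by exists z.
  case: (dsum_cover D (incl z)) => -[a e]; [left|right].
    have [x hx] : onb a by apply/(onb_dl D); rewrite e.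
    by exists x; apply: incl_inj; rewrite hf hx.
  have [x hx] : onb a by apply/(onb_dl (dswap D)); rewrite /= e.
  by exists x; apply: incl_inj; rewrite hg hx.
by exists (Dsum ef eg disj cover).
Qed.

Lemma pl_preimage (Y X : space) (f : Y -> X) (Q : set 'rV[R]_(amb X)) :
  pl f -> polyhedron Q ->
  exists P, polyhedron P /\ forall y : Y, P (sval y) <-> Q (sval (f y)).
Proof.
move=> [s hs] pQ.
exists [set y | exists2 p, p \in s & in_cell p.1 y /\ Q (y *m p.2.1 + p.2.2)]; split.
  apply: (polyhedron_big (s := s)) => p _; apply: polyhedronI; first exact: polyhedron_cell.
  exact: polyhedron_affine.
move=> y; have [[p ps hp] hf] := hs y; split=> [[q qs [hq]]|h].
  by rewrite (hf q qs hq).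
by exists p => //; rewrite -hf.
Qed.

(** A PL map to a disjoint union decomposes its source, as the preimages of the
    summands are clopen and cut out by polyhedra. *)
Lemma pull_dsum d d' (Y : mfd d') (A B X : mfd d) (D : dsum A B X) (f : Y -> X) :
  pl f -> exists YA YB (E : dsum YA YB Y) (gA : YA -> A) (gB : YB -> B),
    [/\ pl gA, pl gB, (forall y, f (dl E y) = dl D (gA y))
      & forall y, f (dr E y) = dr D (gB y)].
Proof.
move=> pf.
have [P [pP hP]] := pl_preimage pf (dl_image D).
have [P' [pP' hP']] := pl_preimage pf (dl_image (dswap D)).
have cov x : car Y x -> P x \/ P' x.
  move=> Yx; rewrite (hP (exist _ x Yx)) (hP' (exist _ x Yx)).
  by case: (dsum_cover D (f (exist _ x Yx))) => -[a <-]; [left|right]; exists a.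
have dis x : car Y x -> P x -> ~ P' x.
  move=> Yx /(hP (exist _ x Yx))[a ea] /(hP' (exist _ x Yx))[b eb].
  by apply: (@dsum_disj _ _ _ _ _ D a b); apply: pt_inj; rewrite ea eb.
have [YA [YB [E [hA hB]]]] := clopen_dsum pP pP' cov dis.
have [|gA [pA eA]] := @dl_lift _ _ _ _ D _ (f \o dl E) (pl_comp pf (proj1 (dl_emb E))).
  move=> y; have /hP[a ha] : P (sval (dl E y)) by apply/hA; exists y.
  by exists a; exact: pt_inj.
have [|gB [pB eB]] := @dl_lift _ _ _ _ (dswap D) _ (f \o dr E) (pl_comp pf (proj1 (dr_emb E))).
  move=> y; have /hP'[a ha] : P' (sval (dr E y)) by apply/hB; exists y.
  by exists a; exact: pt_inj.
by exists YA, YB, E, gA, gB; split=> // y; exact: esym (eB y).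
Qed.

(** Associativity of disjoint unions: first the complement N of X in
    (X + Y) + W, then its decomposition as Y + W. *)
Lemma dsum_compl d (X Y W XY Z : mfd d) (D1 : dsum X Y XY) (D2 : dsum XY W Z) :
  exists N (D4 : dsum X N Z), forall x, dl D4 x = dl D2 (dl D1 x).
Proof.
have ex := embedding_comp (dl_emb D2) (dl_emb D1).
have ey := embedding_comp (dl_emb D2) (dr_emb D1).
pose P := [set z | exists y, sval ((dl D2 \o dr D1) y) = z] `|`
  [set z | exists w, sval (dr D2 w) = z].
pose P' := [set z | exists x, sval ((dl D2 \o dl D1) x) = z].
have pP : polyhedron P.
  apply: polyhedronU; last exact: (dl_image (dswap D2)).
  by apply: embedding_image ey; exact: mfd_polyhedron.
have pP' : polyhedron P' by apply: embedding_image ex; exact: mfd_polyhedron.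
have cov z : car Z z -> P z \/ P' z.
  move=> Zz; case: (dsum_cover D2 (exist _ z Zz)) => -[t e]; last first.
    by left; right; exists t; rewrite e.
  case: (dsum_cover D1 t) => -[u eu]; [right|left; left]; exists u => /=;
    by rewrite eu e.
have dis z : car Z z -> P z -> ~ P' z.
  move=> _ [] [t <-] [x /pt_inj /=]; last exact: dsum_disj.
  by move=> /dl_inj; exact: dsum_disj.
have [N [B [D [hA hB]]]] := clopen_dsum pP pP' cov dis.
have dis4 x t : (dl D2 \o dl D1) x <> dl D t.
  move=> e; have Pt : P (sval (dl D t)) by apply/hA; exists t.
  by apply: (dis _ (svalP _) Pt); exists x; rewrite e.
have cov4 z : (exists x, (dl D2 \o dl D1) x = z) \/ (exists t, dl D t = z).
  by case: (cov _ (svalP z)) => [/hA|[x /pt_inj e]]; [right|left; exists x].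
by exists N, (Dsum ex (dl_emb D) dis4 cov4).
Qed.

Lemma dsum_factor d (X Y W XY N Z : mfd d) (D1 : dsum X Y XY) (D2 : dsum XY W Z)
    (D4 : dsum X N Z) :
  (forall x, dl D4 x = dl D2 (dl D1 x)) ->
  exists D3 : dsum Y W N,
    (forall y, dr D4 (dl D3 y) = dl D2 (dr D1 y)) /\
    (forall w, dr D4 (dr D3 w) = dr D2 w).
Proof.
move=> e4.
have ey := embedding_comp (dl_emb D2) (dr_emb D1).
have rN z : ~ (exists x, dl D2 (dl D1 x) = z) -> exists t, dr D4 t = z.
  move=> h; case: (dsum_cover D4 z) => -[t et]; last by exists t.
  by case: h; exists t; rewrite -e4.
have rY y : exists a, dl (dswap D4) a = (dl D2 \o dr D1) y.
  by apply: rN => -[x /dl_inj]; exact: dsum_disj.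
have rW w : exists a, dl (dswap D4) a = dr D2 w.
  by apply: rN => -[x]; exact: dsum_disj.
have [gY [pgY egY]] := dl_lift (proj1 ey) rY.
have [gW [pgW egW]] := dl_lift (proj1 (dr_emb D2)) rW.
have emY : embedding gY.
  by split=> // y y' e; apply: (proj2 ey); rewrite -!egY e.
have emW : embedding gW.
  by split=> // y y' e; apply: (dr_inj (D := D2)); rewrite -!egW e.
have dis3 y w : gY y <> gW w.
  by move=> /(congr1 (dr D4)); rewrite [LHS]egY [RHS]egW; exact: dsum_disj.
have cov3 t : (exists y, gY y = t) \/ (exists w, gW w = t).
  case: (dsum_cover D2 (dr D4 t)) => -[u eu]; last first.
    by right; exists u; apply: (dr_inj (D := D4)); rewrite [LHS]egW.
  case: (dsum_cover D1 u) => -[v ev].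
    by have := e4 v; rewrite ev eu => /dsum_disj.
  by left; exists v; apply: (dr_inj (D := D4)); rewrite [LHS]egY /= ev.
by exists (Dsum emY emW dis3 cov3); split.
Qed.

(** The gluing GA is the part of the gluing G over the clopen pieces A of X and
    A' of Xgl included by f and f'.  The glued part of the boundary of A and its
    complement are the preimages of those of X, included by iY and iW. *)
Record subgluing d (A A' X Xgl : mfd d) (f : A -> X) (f' : A' -> Xgl)
    (G : gluing X Xgl) (GA : gluing A A')
    (iY : gY GA -> gY G) (iW : gW GA -> gW G) : Prop := SubGluing {
  sg_iY : embedding iY;
  sg_iW : embedding iW;
  sg_q : forall p, gq G (f p) = f' (gq GA p);
  sg_1 : forall y, incl (gj1 G (iY y)) = f (incl (gj1 GA y));
  sg_2 : forall y, incl (gj2 G (iY y)) = f (incl (gj2 GA y));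
  sg_k : forall w, incl (gk G (iW w)) = f (incl (gk GA w));
  sg_Y : forall y a, incl (gj1 G y) = f a -> exists y', iY y' = y;
  sg_Y2 : forall y a, incl (gj2 G y) = f a -> exists y', iY y' = y;
  sg_W : forall w a, incl (gk G w) = f a -> exists w', iW w' = w }.

Lemma gq_glue d (X Xgl : mfd d) (G : gluing X Xgl) y :
  gq G (incl (gj1 G y)) = gq G (incl (gj2 G y)).
Proof. by apply/gq_fib; apply: Or32; exists y. Qed.

(** Glued points have the same image in Xgl, hence belong to the same summand
    of X; so everything restricts to the summands. *)
Lemma sub_gluing d (A B X A' B' Xgl : mfd d) (G : gluing X Xgl)
    (D : dsum A B X) (D' : dsum A' B' Xgl) :
  (forall a, exists a', gq G (dl D a) = dl D' a') ->
  (forall b, exists b', gq G (dr D b) = dr D' b') ->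
  exists (GA : gluing A A') (iY : gY GA -> gY G) (iW : gW GA -> gW G),
    subgluing (dl D) (dl D') iY iW.
Proof.
move=> hA hB; have [Db [Dbl Dbr]] := bd_dsum D.
have [YA [YB [EY [j1 [j1' [pj1 _ e1 e1']]]]]] := pull_dsum Db (proj1 (gj1_emb G)).
have [WA [WB [EW [k [k' [pk _ ek ek']]]]]] := pull_dsum Db (proj1 (gk_emb G)).
have [|j2 [pj2 e2]] := @dl_lift _ _ _ _ Db _ (gj2 G \o dl EY)
    (pl_comp (proj1 (gj2_emb G)) (proj1 (dl_emb EY))).
  move=> y; case: (dsum_cover Db (gj2 G (dl EY y))) => -[a ea]; first by exists a.
  have := @gq_glue _ _ _ G (dl EY y); rewrite e1 -ea Dbl Dbr.
  have [a' ->] := hA (incl (j1 y)); have [b' ->] := hB (incl a).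
  by move=> e; case: (dsum_disj e).
have [|q [pq eq]] := @dl_lift _ _ _ _ D' _ (gq G \o dl D)
    (pl_comp (gq_pl G) (proj1 (dl_emb D))).
  by move=> a; have [a' e] := hA a; exists a'.
have inj1 : embedding j1.
  split=> // y y' e; apply: (dl_inj (D := EY)); apply: (proj2 (gj1_emb G)).
  by rewrite !e1 e.
have inj2 : embedding j2.
  split=> // y y' e; apply: (dl_inj (D := EY)); apply: (proj2 (gj2_emb G)).
  by rewrite -[LHS]e2 -[RHS]e2 e.
have injk : embedding k.
  split=> // y y' e; apply: (dl_inj (D := EW)); apply: (proj2 (gk_emb G)).
  by rewrite !ek e.
have i2 y : incl (gj2 G (dl EY y)) = dl D (incl (j2 y)) by rewrite -Dbl e2.
have i1 y : incl (gj1 G (dl EY y)) = dl D (incl (j1 y)) by rewrite -Dbl e1.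
have ik w : incl (gk G (dl EW w)) = dl D (incl (k w)) by rewrite -Dbl ek.
have rY y : (exists a, gj1 G y = dl Db a) -> exists y', dl EY y' = y.
  move=> [a ea]; case: (dsum_cover EY y) => -[y' ey']; first by exists y'.
  by have := e1' y'; rewrite ey' ea => /dsum_disj.
have rY2 y : (exists a, gj2 G y = dl Db a) -> exists y', dl EY y' = y.
  move=> [a ea]; apply: rY; case: (dsum_cover Db (gj1 G y)) => -[b eb].
    by exists b.
  have := @gq_glue _ _ _ G y; rewrite -eb ea Dbl Dbr.
  have [a' ->] := hA (incl a); have [b' ->] := hB (incl b).
  by move=> e; case: (dsum_disj (esym e)).
have rW w : (exists a, gk G w = dl Db a) -> exists w', dl EW w' = w.
  move=> [a ea]; case: (dsum_cover EW w) => -[w' ew']; first by exists w'.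
  by have := ek' w'; rewrite ew' ea => /dsum_disj.
have eqp p : gq G (dl D p) = dl D' (q p) by rewrite eq.
have surj z : exists x, q x = z.
  have [x ex] := gq_surj G (dl D' z).
  case: (dsum_cover D x) => -[a ea].
    by exists a; apply: (dl_inj (D := D')); rewrite -eqp ea.
  have [b' eb'] := hB a; move: ex; rewrite -ea eb' => e.
  by case: (dsum_disj (esym e)).
have jdisj y y' : j1 y <> j2 y'.
  by move=> /(congr1 (dl Db)); rewrite -e1 e2; exact: gj_disj.
have cover b : (exists y, b = j1 y \/ b = j2 y) \/ (exists w, b = k w).
  have [[y [e|e]]|[w e]] := g_cover G (dl Db b).
  - have [y' ey'] : exists y', dl EY y' = y by apply: rY; exists b.
    by left; exists y'; left; apply: (dl_inj (D := Db)); rewrite -e1 ey'.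
  - have [y' ey'] : exists y', dl EY y' = y by apply: rY2; exists b.
    by left; exists y'; right; apply: (dl_inj (D := Db)); rewrite e2 /= ey'.
  have [w' ew'] : exists w', dl EW w' = w by apply: rW; exists b.
  by right; exists w'; apply: (dl_inj (D := Db)); rewrite -ek ew'.
have meet y w : j1 y = k w \/ j2 y = k w ->
    (exists y0 : bdy YA, incl y0 = y) /\ (exists w0 : bdy WA, incl w0 = w).
  move=> h; have [hy hw] : onb (dl EY y) /\ onb (dl EW w).
    apply: (g_meet (g := G)); case: h => e; [left|right].
      by rewrite e1 ek e.
    by rewrite -[LHS]e2 ek e.
  by split; [apply/(onb_dl EY)|apply/(onb_dl EW)].
have bdY (y0 : bdy YA) :
    (exists w0 : bdy WA, j1 (incl y0) = k (incl w0)) /\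
    (exists w0 : bdy WA, j2 (incl y0) = k (incl w0)).
  have [y1 ey1] : onb (dl EY (incl y0)) by apply/onb_dl; exists y0.
  have [[w1 h1] [w2 h2]] := g_bdY (g := G) y1; move: h1 h2; rewrite ey1 => h1 h2.
  have [t1 et1] : exists w', dl EW w' = incl w1.
    by apply: rW; exists (j1 (incl y0)); rewrite -e1.
  have [t2 et2] : exists w', dl EW w' = incl w2.
    by apply: rW; exists (j2 (incl y0)); rewrite e2.
  have [w1' ew1'] : onb t1 by apply/(onb_dl EW); rewrite et1; exists w1.
  have [w2' ew2'] : onb t2 by apply/(onb_dl EW); rewrite et2; exists w2.
  split; [exists w1'|exists w2']; apply: (dl_inj (D := Db)).
    by rewrite -e1 -ek ew1' et1.
  by rewrite e2 -ek ew2' et2.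
have bdW (w0 : bdy WA) : exists y0 : bdy YA,
    j1 (incl y0) = k (incl w0) \/ j2 (incl y0) = k (incl w0).
  have [w1 ew1] : onb (dl EW (incl w0)) by apply/onb_dl; exists w0.
  have [y1 h] := g_bdW (g := G) w1; rewrite ew1 ek in h.
  have [t et] : exists y', dl EY y' = incl y1.
    by case: h => h; [apply: rY|apply: rY2]; eexists; exact: h.
  have [y0 ey0] : onb t by apply/(onb_dl EY); rewrite et; exists y1.
  exists y0; rewrite ey0; case: h => h; [left|right]; apply: (dl_inj (D := Db)).
    by rewrite -e1 et.
  by rewrite e2 /= et.
have fib p p' : q p = q p' <->
    [\/ p = p', (exists y, p = incl (j1 y) /\ p' = incl (j2 y))
      | (exists y, p = incl (j2 y) /\ p' = incl (j1 y))].
  have -> : (q p = q p') <-> (gq G (dl D p) = gq G (dl D p')).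
    by rewrite !eqp; split=> [->//|/dl_inj].
  split=> [/gq_fib|h].
  - case=> [/dl_inj ->|[y [h1 h2]]|[y [h1 h2]]]; first exact: Or31.
      have [y' ey'] : exists y', dl EY y' = y.
        case: (dsum_cover EY y) => -[t et]; first by exists t.
        have := congr1 (fun b => incl b) (e1' t).
        by rewrite et -h1 Dbr => /dsum_disj.
      apply: Or32; exists y'; rewrite -ey' in h1 h2.
      by split; apply: (dl_inj (D := D)); rewrite ?h1 ?h2.
    have [y' ey'] : exists y', dl EY y' = y.
      case: (dsum_cover EY y) => -[t et]; first by exists t.
      have := congr1 (fun b => incl b) (e1' t).
      by rewrite et -h2 Dbr => /dsum_disj.
    apply: Or33; exists y'; rewrite -ey' in h1 h2.
    by split; apply: (dl_inj (D := D)); rewrite ?h1 ?h2.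
  - apply/gq_fib; case: h => [->|[y [-> ->]]|[y [-> ->]]]; first exact: Or31.
      by apply: Or32; exists (dl EY y).
    by apply: Or33; exists (dl EY y).
exists (Gluing inj1 inj2 injk pq surj jdisj cover meet bdY bdW fib), (dl EY), (dl EW).
split=> //=; try exact: dl_emb.
- move=> y a e; apply: rY; have [b hb] : onb a.
    by apply/(onb_dl D); rewrite -e; eexists.
  by exists b; apply: incl_inj; rewrite Dbl hb.
- move=> y a e; apply: rY2; have [b hb] : onb a.
    by apply/(onb_dl D); rewrite -e; eexists.
  by exists b; apply: incl_inj; rewrite Dbl hb.
- move=> w a e; apply: rW; have [b hb] : onb a.
    by apply/(onb_dl D); rewrite -e; eexists.
  by exists b; apply: incl_inj; rewrite Dbl hb.
Qed.

Lemma sub_dsums d (A B X A' B' Xgl : mfd d) (G : gluing X Xgl)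
    (D : dsum A B X) (D' : dsum A' B' Xgl)
    (GA : gluing A A') (iY : gY GA -> gY G) (iW : gW GA -> gW G)
    (GB : gluing B B') (jY : gY GB -> gY G) (jW : gW GB -> gW G) :
  subgluing (dl D) (dl D') iY iW ->
  subgluing (dr D) (dr D') jY jW ->
  exists (DY : dsum (gY GA) (gY GB) (gY G)) (DW : dsum (gW GA) (gW GB) (gW G)),
    [/\ (forall y, dl DY y = iY y), (forall y, dr DY y = jY y),
        (forall w, dl DW w = iW w) & (forall w, dr DW w = jW w)].
Proof.
move=> sA sB.
have d1 y y' : iY y <> jY y'.
  move=> /(congr1 (fun t => incl (gj1 G t))); rewrite (sg_1 sA) (sg_1 sB).
  exact: dsum_disj.
have d2 y y' : iW y <> jW y'.
  move=> /(congr1 (fun t => incl (gk G t))); rewrite (sg_k sA) (sg_k sB).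
  exact: dsum_disj.
have c1 z : (exists y, iY y = z) \/ (exists y, jY y = z).
  by case: (dsum_cover D (incl (gj1 G z))) => -[a /esym e];
    [left; apply: (sg_Y sA e)|right; apply: (sg_Y sB e)].
have c2 z : (exists y, iW y = z) \/ (exists y, jW y = z).
  by case: (dsum_cover D (incl (gk G z))) => -[a /esym e];
    [left; apply: (sg_W sA e)|right; apply: (sg_W sB e)].
by exists (Dsum (sg_iY sA) (sg_iY sB) d1 c1), (Dsum (sg_iW sA) (sg_iW sB) d2 c2).
Qed.

(** The decomposition CA of the boundary of A is the part of the decomposition C
    of the boundary of X lying over the boundary of A. *)
Record subcut d (A A' B X Xgl : mfd d) (Db : dsum (bdy A) (bdy B) (bdy X))
    (G : gluing X Xgl) (GA : gluing A A') (iY : gY GA -> gY G) (iW : gW GA -> gW G)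
    (C : cutbd G) (CA : cutbd GA) (i1 : cb1 CA -> cb1 C) (i2 : cb2 CA -> cb2 C)
    (kY : gY (cbG CA) -> gY (cbG C)) (kW : gW (cbG CA) -> gW (cbG C)) : Prop :=
  SubCut {
  sc_i1 : embedding i1;
  sc_i2 : embedding i2;
  sc_g : subgluing i2 (dl Db) kY kW;
  sc_yl : forall y, i1 (dl (cbYY CA) y) = dl (cbYY C) (iY y);
  sc_yr : forall y, i1 (dr (cbYY CA) y) = dr (cbYY C) (iY y);
  sc_l : forall p, i2 (dl (cbYYW CA) p) = dl (cbYYW C) (i1 p);
  sc_r : forall w, i2 (dr (cbYYW CA) w) = dr (cbYYW C) (iW w);
  sc_im1 : forall p b, gq (cbG C) (dl (cbYYW C) p) = dl Db b -> exists p', i1 p' = p;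
  sc_im2 : forall p b, gq (cbG C) p = dl Db b -> exists p', i2 p' = p }.

Lemma sub_cutbd d (A B X A' Xgl : mfd d) (D : dsum A B X) (f' : A' -> Xgl)
    (Db : dsum (bdy A) (bdy B) (bdy X)) (G : gluing X Xgl) (GA : gluing A A')
    (iY : gY GA -> gY G) (iW : gW GA -> gW G) (C : cutbd G) :
  (forall p, incl (dl Db p) = dl D (incl p)) ->
  subgluing (dl D) f' iY iW ->
  exists (CA : cutbd GA) (i1 : cb1 CA -> cb1 C) (i2 : cb2 CA -> cb2 C)
      (kY : gY (cbG CA) -> gY (cbG C)) (kW : gW (cbG CA) -> gW (cbG C)),
    subcut Db iY iW i1 i2 kY kW.
Proof.
move=> Dbl sA; pose q := gq (cbG C).
have pq : pl q by exact: gq_pl.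
have [c2 [c2' [E2 [q2 [q2' [_ _ eq2 eq2']]]]]] := pull_dsum Db pq.
have pq1 : pl (q \o dl (cbYYW C)) by apply: pl_comp pq (proj1 (dl_emb _)).
have [c1 [c1' [E1 [q1 [q1' [_ _ eq1 eq1']]]]]] := pull_dsum Db pq1.
have im2 p b : q p = dl Db b -> exists p', dl E2 p' = p.
  move=> e; case: (dsum_cover E2 p) => -[t et]; first by exists t.
  by have := eq2' t; rewrite et e => /dsum_disj.
have im1 p b : q (dl (cbYYW C) p) = dl Db b -> exists p', dl E1 p' = p.
  move=> e; case: (dsum_cover E1 p) => -[t et]; first by exists t.
  by have := eq1' t; rewrite /= et e => h; case: (@dsum_disj _ _ _ _ _ Db _ _ h).
have J1 y : gj1 G (iY y) = dl Db (gj1 GA y).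
  by apply: incl_inj; rewrite (sg_1 sA) Dbl.
have J2 y : gj2 G (iY y) = dl Db (gj2 GA y).
  by apply: incl_inj; rewrite (sg_2 sA) Dbl.
have Jk y : gk G (iW y) = dl Db (gk GA y).
  by apply: incl_inj; rewrite (sg_k sA) Dbl.
have [|yl [pyl eyl]] := @dl_lift _ _ _ _ E1 _ (dl (cbYY C) \o iY)
    (pl_comp (proj1 (dl_emb _)) (proj1 (sg_iY sA))).
  by move=> y; apply: (im1 _ (gj1 GA y)); rewrite -J1 -(cb_j1 C).
have [|yr [pyr eyr]] := @dl_lift _ _ _ _ E1 _ (dr (cbYY C) \o iY)
    (pl_comp (proj1 (dr_emb _)) (proj1 (sg_iY sA))).
  by move=> y; apply: (im1 _ (gj2 GA y)); rewrite -J2 -(cb_j2 C).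
have [|wl [pwl ewl]] := @dl_lift _ _ _ _ E2 _ (dl (cbYYW C) \o dl E1)
    (pl_comp (proj1 (dl_emb _)) (proj1 (dl_emb _))).
  by move=> p; apply: (im2 _ (q1 p)); rewrite -eq1.
have [|wr [pwr ewr]] := @dl_lift _ _ _ _ E2 _ (dr (cbYYW C) \o iW)
    (pl_comp (proj1 (dr_emb _)) (proj1 (sg_iW sA))).
  by move=> p; apply: (im2 _ (gk GA p)); rewrite -Jk -(cb_k C).
have myl : embedding yl.
  split=> // y y' e; apply: (proj2 (sg_iY sA)); apply: (dl_inj (D := cbYY C)).
  by rewrite -[LHS]eyl -[RHS]eyl e.
have myr : embedding yr.
  split=> // y y' e; apply: (proj2 (sg_iY sA)); apply: (dr_inj (D := cbYY C)).
  by rewrite -[LHS]eyr -[RHS]eyr e.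
have mwl : embedding wl.
  split=> // y y' e; apply: (dl_inj (D := E1)); apply: (dl_inj (D := cbYYW C)).
  by rewrite -[LHS]ewl -[RHS]ewl e.
have mwr : embedding wr.
  split=> // y y' e; apply: (proj2 (sg_iW sA)); apply: (dr_inj (D := cbYYW C)).
  by rewrite -[LHS]ewr -[RHS]ewr e.
have d1 y y' : yl y <> yr y'.
  by move=> /(congr1 (dl E1)); rewrite eyl eyr; exact: dsum_disj.
have d2 y y' : wl y <> wr y'.
  by move=> /(congr1 (dl E2)); rewrite ewl ewr; exact: dsum_disj.
have rY y b : gj1 G y = dl Db b -> exists y', iY y' = y.
  by move=> e; apply: (sg_Y sA (a := incl b)); rewrite e Dbl.
have rW y b : gk G y = dl Db b -> exists y', iW y' = y.
  by move=> e; apply: (sg_W sA (a := incl b)); rewrite e Dbl.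
have rY2 y b : gj2 G y = dl Db b -> exists y', iY y' = y.
  by move=> e; apply: (sg_Y2 sA (a := incl b)); rewrite e Dbl.
have v1 z : (exists y, yl y = z) \/ (exists y, yr y = z).
  case: (dsum_cover (cbYY C) (dl E1 z)) => -[y ey]; [left|right].
    have [|y' ey'] := rY y (q1 z); first by rewrite -(cb_j1 C) ey -eq1.
    by exists y'; apply: (dl_inj (D := E1)); rewrite eyl /= ey'.
  have [|y' ey'] := rY2 y (q1 z); first by rewrite -(cb_j2 C) ey -eq1.
  by exists y'; apply: (dl_inj (D := E1)); rewrite eyr /= ey'.
have v2 z : (exists y, wl y = z) \/ (exists y, wr y = z).
  case: (dsum_cover (cbYYW C) (dl E2 z)) => -[y ey]; [left|right].
    have [|y' ey'] := im1 y (q2 z); first by rewrite ey eq2.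
    by exists y'; apply: (dl_inj (D := E2)); rewrite ewl /= ey'.
  have [|y' ey'] := rW y (q2 z); first by rewrite -(cb_k C) ey; exact: eq2.
  by exists y'; apply: (dl_inj (D := E2)); rewrite ewr /= ey'.
have [||GC [kY [kW sC]]] := @sub_gluing _ _ _ _ _ _ _ (cbG C) E2 Db.
- by move=> a; exists (q2 a); rewrite -eq2.
- by move=> a; exists (q2' a); rewrite -eq2'.
have sq p : dl Db (gq GC p) = q (dl E2 p) by rewrite -(sg_q sC).
have cj1 y : gq GC (wl (yl y)) = gj1 GA y.
  by apply: (dl_inj (D := Db)); rewrite sq ewl /= eyl /= /q (cb_j1 C) J1.
have cj2 y : gq GC (wl (yr y)) = gj2 GA y.
  by apply: (dl_inj (D := Db)); rewrite sq ewl /= eyr /= /q (cb_j2 C) J2.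
have ck w : gq GC (wr w) = gk GA w.
  by apply: (dl_inj (D := Db)); rewrite sq ewr /= /q (cb_k C) Jk.
have sdY t : exists p, incl (gj1 GC t) = wl p.
  have [p ep] := cb_sideY (kY t).
  have [|p' ep'] := im1 p (gq GC (incl (gj1 GC t))).
    by rewrite -ep (sg_1 sC) sq.
  by exists p'; apply: (dl_inj (D := E2)); rewrite -(sg_1 sC) ep ewl /= ep'.
have sdW t : exists w, incl (gj2 GC t) = wr w.
  have [w ew] := cb_sideW (kY t).
  have [|w' ew'] := rW w (gq GC (incl (gj2 GC t))).
    by rewrite -(cb_k C) -ew (sg_2 sC) sq.
  by exists w'; apply: (dl_inj (D := E2)); rewrite -(sg_2 sC) ew ewr /= ew'.
by exists (@Cutbd _ _ _ _ GA c1 c2 (Dsum myl myr d1 v1) (Dsum mwl mwr d2 v2) GC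
  cj1 cj2 ck sdY sdW), (dl E1), (dl E2), kY, kW; split=> //=; exact: dl_emb.
Qed.

End Pieces.
(** * Stages of a gluing decomposition *)

Section Stages.
Variable R : realType.
Local Notation space := (Defs.space R).
Local Notation mfd := (mfd R).

Lemma homeo_embedding (X Y : space) (h : homeo X Y) : embedding h.
Proof. by split; [exact: hfun_pl|exact: can_inj (hfunK h)]. Qed.

Lemma inner_homeo k d (X Y : mfd d) (h : homeo X Y) p :
  inner k p -> inner k (h p).
Proof.
move=> hp; apply/inner_embedding => //; first exact: mfd_polyhedron.
- exact: mfd_compact.
- exact: homeo_embedding.
- near=> z => Yz; exists (hinv h (exist _ z Yz)).
  by rewrite hinvK.
Unshelve. all: by end_near.
Qed.

Lemma total_map_pl d (X M : mfd d) (t : decomp X M) : pl (total_map t).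
Proof.
elim: t => [M' h|M' M'' G t' IH] /=; first exact: hfun_pl.
by apply: pl_comp IH _; exact: gq_pl.
Qed.

Lemma total_map_inner d (X M : mfd d) (t : decomp X M) p :
  inner d.-1 p -> inner d.-1 (total_map t p).
Proof.
elim: t p => [M' h|M' M'' G t' IH] p hp /=; first exact: inner_homeo.
by apply: IH; exact: gq_inner.
Qed.

(** An inner point is not identified with any other point by the first gluing,
    and is still inner for the next ones. *)
Lemma total_map_fiber d (X M : mfd d) (t : decomp X M) p p' :
  inner d.-1 p -> total_map t p' = total_map t p -> p' = p.
Proof.
elim: t p p' => [M' h|M' M'' G t' IH] p p' hp /= e.
  exact: (proj2 (homeo_embedding h)) e.
by apply: (inner_gq hp); apply: IH e; exact: gq_inner.
Qed.

Lemma ball_inner d (X : mfd d.+1) : is_ball X -> exists p : X, inner d p.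
Proof.
move=> [h]; pose v : 'rV[R]_d := const_mx (2^-1).
have hv i : 0 < v 0 i < 1 by rewrite mxE; apply/andP; split; lra.
have cv : car (cube R d) v by move=> i; have /andP[/ltW -> /ltW ->] := hv i.
pose c : cube R d := exist _ v cv.
exists (hinv h c), (hinv h); split; last by exists c.
split; first exact: (homeo_embedding (homeo_inv h)).
by near=> z => Xz; exists (h (exist _ z Xz)); rewrite hfunK.
Unshelve. all: by end_near.
Qed.

(** The preimages of the two summands are closed and complementary. *)
Lemma connected_dsum d d' (A : mfd d') (B W N : mfd d) (D : dsum B W N) (f : A -> N) :
  connected (car A) -> pl f ->
  (forall p, exists b, f p = dl D b) \/ (forall p, exists w, f p = dr D w).
Proof.
move=> cA pf.
have [P [pP hP]] := pl_preimage pf (dl_image D).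
have [P' [pP' hP']] := pl_preimage pf (dl_image (dswap D)).
have [[p Pp]|no] := pselect (exists p : A, P (sval p)); last first.
  right=> p; case: (dsum_cover D (f p)) => -[t et]; last by exists t.
  by case: no; exists p; apply/hP; exists t; rewrite et.
left=> q; have : car A `&` P = car A.
  apply: cA; first by exists (sval p); split=> //; exact: svalP.
    exists (~` P'); first by rewrite openC; exact: polyhedron_closed.
    rewrite predeqE => x; split=> -[Ax h]; split=> //.
      move: h => /(hP (exist _ x Ax))[b eb] /(hP' (exist _ x Ax))[w ew].
      by apply: (@dsum_disj _ _ _ _ _ D b w); apply: pt_inj; rewrite eb ew.
    apply/(hP (exist _ x Ax)); case: (dsum_cover D (f (exist _ x Ax))) => -[t et].
      by exists t; rewrite et.
    by case: h; apply/(hP' (exist _ x Ax)); exists t; rewrite /= et.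
  by exists P => //; exact: polyhedron_closed.
move=> e; have : (car A `&` P) (sval q) by rewrite e; exact: svalP.
by case=> _ /hP[b /pt_inj eb]; exists b.
Qed.

Lemma stage_suffix d (X M : mfd d) (s : decomp X M) l :
  exists t : decomp X (stage s l), forall p, stage_map s l p = total_map t p.
Proof.
elim: s l => [M' h|M' M'' G s' IH] l /=; first by exists (Done h).
by case: l => [|l]; [exists (Step G s')|exact: IH].
Qed.

(** The centre of the ball Bi is alone in its fibre over the glued manifold, and
    its image is that of a point of Bj.  So the gluings between the two stages
    map the component of the earlier stage, which is connected, into that of the
    later stage.  If Bj came first, its image would be contained in that of Bi. *)
Lemma nested_stages d (X M : mfd d.+1) (s : decomp X M) li lj (Bi Wi Bj Wj : mfd d.+1)
    (Di : dsum Bi Wi (stage s li)) (Dj : dsum Bj Wj (stage s lj)) :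
  connected (car Bi) -> connected (car Bj) -> is_ball Bi ->
  [set stage_map s li (dl Di p) | p in setT] `<`
    [set stage_map s lj (dl Dj p) | p in setT] ->
  (forall t : decomp (stage s li) (stage s lj),
     ~ (forall p, stage_map s lj p = stage_map s li (total_map t p))) /\
  (forall t : decomp (stage s lj) (stage s li),
     (forall p, stage_map s li p = stage_map s lj (total_map t p)) ->
     forall p, exists p', total_map t (dl Di p) = dl Dj p').
Proof.
move=> ci cj bi [sub nsub]; have [c hc] := ball_inner bi.
have hcD : inner d (dl Di c) by apply/inner_dl.
have [c' ec] : exists p, stage_map s lj (dl Dj p) = stage_map s li (dl Di c).
  by have [|p _ e] := sub (stage_map s li (dl Di c)); [exists c|exists p].
split=> t ht.
  have := connected_dsum Di cj (pl_comp (total_map_pl t) (proj1 (dl_emb Dj))).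
  case=> h.
    apply: nsub => _ [p _ <-]; have [b eb] := h p.
    by exists b => //; rewrite ht -eb.
  have [w ew] := h c'; have [u hu] := stage_suffix s li.
  have := @total_map_fiber _ _ _ u (dl Di c) (dr Di w) hcD.
  rewrite -!hu -ew /= -ht ec => /(_ erefl) e.
  by move: ew; rewrite /= e => /dsum_disj.
have := connected_dsum Dj ci (pl_comp (total_map_pl t) (proj1 (dl_emb Di))).
case=> // h; have [w ew] := h c; have [u hu] := stage_suffix s lj.
have := @total_map_fiber _ _ _ u (total_map t (dl Di c)) (dl Dj c') (total_map_inner t hcD).
rewrite -!hu -ht ec => /(_ erefl); rewrite -/((total_map t \o dl Di) c) ew.
by move=> /dsum_disj.
Qed.

End Stages.
(** * Fields on disjoint unions *)

Section FieldLemmas.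
Variables (R : realType) (K : fieldType) (n : nat) (F : fields R K n).
Local Notation mfd := (mfd R).
Let FP := fieldsP F.

(** Both sides are equal to x * (x' * (y * y')), up to the identification of the
    complement of X in Z with Y + (X' + Y') and with X' + (Y + Y'). *)
Lemma dju_interchange d (hd : (d <= n.+1)%N) (X Y X' Y' P Q S T Z : mfd d)
    (D : dsum P Q Z) (D1 : dsum X Y P) (D2 : dsum X' Y' Q)
    (E : dsum S T Z) (E1 : dsum X X' S) (E2 : dsum Y Y' T) :
  (forall x, dl D (dl D1 x) = dl E (dl E1 x)) ->
  (forall y, dl D (dr D1 y) = dr E (dl E2 y)) ->
  (forall x, dr D (dl D2 x) = dl E (dr E1 x)) ->
  (forall y, dr D (dr D2 y) = dr E (dr E2 y)) ->
  forall (x : fld F X) (y : fld F Y) (x' : fld F X') (y' : fld F Y'),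
  dju D (dju D1 x y) (dju D2 x' y') = dju E (dju E1 x x') (dju E2 y y').
Proof.
move=> h1 h2 h3 h4 x y x' y'.
have [N [D4 e4]] := dsum_compl D1 D.
have [D3 [e31 e32]] := dsum_factor e4.
have e4' z : dl D4 z = dl E (dl E1 z) by rewrite e4 h1.
have [D5 [e51 e52]] := dsum_factor e4'.
rewrite (dju_assoc FP hd (D3 := D3) (D4 := D4)) //.
rewrite (dju_assoc FP hd (D1 := E1) (D2 := E) (D3 := D5) (D4 := D4)) //.
congr (dju D4 x _).
rewrite -(dju_sym FP hd (D := D3) (D' := dswap D3)) //.
rewrite -(dju_sym FP hd (D := E2) (D' := dswap E2)) //.
apply: (dju_assoc FP hd) => z /=; apply: (dr_inj (D := D4)).
- by rewrite e32 e51 h3.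
- by rewrite e32 e52 h4.
- by rewrite e31 e52 h2.
Qed.

Lemma dju_split d (hd : (d <= n)%N) (X W Z : mfd d) (D : dsum X W Z) (z : fld F Z) :
  exists x w, z = dju D x w.
Proof.
have [g _ gK] := dju_bij FP hd D.
by exists (g z).1, (g z).2; rewrite -[LHS]gK.
Qed.

Lemma dju_inj d (hd : (d <= n)%N) (X W Z : mfd d) (D : dsum X W Z)
    (x x' : fld F X) (w w' : fld F W) :
  dju D x w = dju D x' w' -> x = x' /\ w = w'.
Proof.
move=> e; have := bij_inj (dju_bij FP hd D) (x1 := (x, w)) (x2 := (x', w')).
by move=> /(_ e) [-> ->].
Qed.

(** If a field on a disjoint union can be glued then so can its two parts: by
    induction on the dimension, the boundary condition that makes it splittable
    is itself glued from a disjoint union. *)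
Lemma glued_split d (hd : (d <= n.+1)%N) (A B X A' B' Xgl : mfd d)
    (G : gluing X Xgl) (D : dsum A B X) (D' : dsum A' B' Xgl)
    (GA : gluing A A') (iY : gY GA -> gY G) (iW : gW GA -> gW G)
    (GB : gluing B B') (jY : gY GB -> gY G) (jW : gW GB -> gW G) :
  subgluing (dl D) (dl D') iY iW -> subgluing (dr D) (dr D') jY jW ->
  forall (a : fld F A) (b : fld F B) z, glued G (dju D a b) z ->
  exists a' b', [/\ glued GA a a', glued GB b b' & z = dju D' a' b'].
Proof.
elim: d hd A B X A' B' Xgl G D D' GA iY iW GB jY jW =>
    [|d IH] hd A B X A' B' Xgl G D D' GA iY iW GB jY jW sA sB a b z gz.
  have [a' _] := fld_empty FP (leq0n n) (spP A').
  have [b' _] := fld_empty FP (leq0n n) (spP B').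
  exists a', b'; split; try exact: (glued_empty FP).
  by apply: (glued_fun FP hd gz); exact: (glued_empty FP).
have dn : (d <= n)%N by [].
have [DY [DW [DYl DYr DWl DWr]]] := sub_dsums sA sB.
suff [[a' ga] [b' gb]] : (exists a', glued GA a a') /\ (exists b', glued GB b b').
  exists a', b'; split=> //; apply: (glued_fun FP hd gz).
  apply: (glued_dju FP hd (DY := DY) _ _ _ _ _ _ ga gb) => p.
  - exact: (sg_q sA).
  - exact: (sg_q sB).
  - by rewrite DYl (sg_1 sA).
  - by rewrite DYl (sg_2 sA).
  - by rewrite DYr (sg_1 sB).
  - by rewrite DYr (sg_2 sB).
have [Db [Dbl Dbr]] := bd_dsum D.
have [e [w [C gC]]] : exists e w, restr F G (dju D a b) e e w.
  by apply/(glued_dom FP hd); exists z.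
have [e1 [e2 ee]] := dju_split dn DY e; have [w1 [w2 ew]] := dju_split dn DW w.
have [CA [i1 [i2 [kY [kW sCA]]]]] := sub_cutbd C Dbl sA.
have [CB [j1 [j2 [lY [lW sCB]]]]] :=
  @sub_cutbd _ _ _ _ _ _ _ (dswap D) _ (dswap Db) _ _ _ _ C Dbr sB.
have d1 p q : i1 p <> j1 q.
  move=> /(congr1 (fun t => gq (cbG C) (dl (cbYYW C) t))).
  rewrite -(sc_l sCA) -(sc_l sCB) (sg_q (sc_g sCA)) (sg_q (sc_g sCB)).
  exact: dsum_disj.
have d2 p q : i2 p <> j2 q.
  move=> /(congr1 (fun t => gq (cbG C) t)).
  rewrite (sg_q (sc_g sCA)) (sg_q (sc_g sCB)); exact: dsum_disj.
have c1 p : (exists x, i1 x = p) \/ (exists x, j1 x = p).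
  case: (dsum_cover Db (gq (cbG C) (dl (cbYYW C) p))) => -[t et]; [left|right].
    exact: (sc_im1 sCA (esym et)).
  exact: (sc_im1 sCB (esym et)).
have c2 p : (exists x, i2 x = p) \/ (exists x, j2 x = p).
  case: (dsum_cover Db (gq (cbG C) p)) => -[t et]; [left|right].
    exact: (sc_im2 sCA (esym et)).
  exact: (sc_im2 sCB (esym et)).
pose D1 := Dsum (sc_i1 sCA) (sc_i1 sCB) d1 c1.
pose D2 := Dsum (sc_i2 sCA) (sc_i2 sCB) d2 c2.
have E1 : dju (cbYY C) (dju DY e1 e2) (dju DY e1 e2) =
    dju D1 (dju (cbYY CA) e1 e1) (dju (cbYY CB) e2 e2).
  apply: (dju_interchange (leqW dn)) => t /=.
  - by rewrite DYl (sc_yl sCA).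
  - by rewrite DYr (sc_yl sCB).
  - by rewrite DYl (sc_yr sCA).
  - by rewrite DYr (sc_yr sCB).
have E2 : dju (cbYYW C) (dju (cbYY C) e e) w =
    dju D2 (dju (cbYYW CA) (dju (cbYY CA) e1 e1) w1)
           (dju (cbYYW CB) (dju (cbYY CB) e2 e2) w2).
  rewrite ee ew E1; apply: (dju_interchange (leqW dn)) => t /=.
  - by rewrite (sc_l sCA).
  - by rewrite (sc_l sCB).
  - by rewrite DWl (sc_r sCA).
  - by rewrite DWr (sc_r sCB).
move: gC; rewrite E2 (dju_res FP hd Dbl Dbr) => gC.
have [a1 [b1 [ga gb /(dju_inj dn)[ea eb]]]] :=
  IH (leqW dn) _ _ _ _ _ _ _ D2 Db _ _ _ _ _ _ (sc_g sCA) (sc_g sCB) _ _ _ gC.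
split; apply/(glued_dom FP hd).
  by exists e1, w1, CA; rewrite ea.
by exists e2, w2, CB; rewrite eb.
Qed.

Lemma lincomb_res a (X : mfd n.+1) (x y z : fld F X) :
  lincomb F a x y z -> res x = res z /\ res y = res z.
Proof.
move=> [c [u [v [-> -> ->]]]].
have h (t : vs c) : res (vec t) = c by apply/(vec_image FP); exists t.
by rewrite !h.
Qed.

Lemma glued_res_eq (X Xgl : mfd n.+1) (G : gluing X Xgl) (x z : fld F X) z' :
  res x = res z -> glued G z z' -> exists x', glued G x x'.
Proof.
move=> e gz; apply/(glued_dom FP (leqnn _)).
have [e' [w [C hC]]] : exists e w, restr F G z e e w.
  by apply/(glued_dom FP (leqnn _)); exists z'.
by exists e', w, C; rewrite e.
Qed.

(** Whether a field can be glued depends only on its boundary condition, which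
    all terms of a linear combination share. *)
Lemma total_glued_lin (X M : mfd n.+1) (t : decomp X M) a (x y z : fld F M) z' :
  lincomb F a x y z -> total_glued F t z z' ->
  exists x' y', [/\ total_glued F t x x', total_glued F t y y'
                  & lincomb F a x' y' z'].
Proof.
elim: t x y z z' => [M' h|M' M'' G t' IH] x y z z' lz /=.
  by move=> ->; exists (act h x), (act h y); split=> //; exact: (act_lin FP).
move=> [z1 gz tz]; have [rx ry] := lincomb_res lz.
have [x1 gx] := glued_res_eq rx gz; have [y1 gy] := glued_res_eq ry gz.
have [z2 gz2 l2] := glued_lin FP lz gx gy.
rewrite -(glued_fun FP (leqnn _) gz gz2) in l2.
have [x' [y' [tx ty l']]] := IH _ _ _ _ l2 tz.
by exists x', y'; split=> //; [exists x1|exists y1].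
Qed.

Lemma linear_morph0 (V W : lmodType K) (f : V -> W) : linear f -> f 0 = 0.
Proof.
by move=> h; have := h (-1) 0 0; rewrite !scaleN1r oppr0 addr0 addNr.
Qed.

Lemma lquot_ker (V : lmodType K) (S : set V) x : lquot_pi S x = 0 -> in_span S x.
Proof.
have -> : 0 = lquot_pi S 0 by rewrite /lquot_pi raddf0.
move=> e; have hx := lquot_repr S x; have h0 := lquot_repr S 0.
rewrite -e subr0 in h0.
have -> : x = generic_quotient.repr (lquot_pi S x) +
    (-1) *: (generic_quotient.repr (lquot_pi S x) - x).
  by rewrite scaleN1r opprB addrC subrK.
by apply: in_spanD => //; exact: in_spanZ.
Qed.

(** By the universal property of the tensor product, fields of the form
    dju D x w span the fields on a disjoint union. *)
Lemma dju_span (X W Z : mfd n.+1) (D : dsum X W Z) (Q : fld F Z -> Prop) :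
  (forall x w, Q (dju D x w)) ->
  (forall a x y z, lincomb F a x y z -> Q x -> Q y -> Q z) ->
  forall z, Q z.
Proof.
move=> hQ lQ z; have [Db [Dbl Dbr]] := bd_dsum D.
have [c [c' ec]] := dju_split (leqnn n) Db (res z).
have [v <-] := (vec_image FP _ z).1 ec.
have [T [Tr Tl eT uT]] := dju_tensor FP Dbl Dbr c c'.
pose S := [set t | exists u u', t = T u u'].
have : in_span S v.
  apply: lquot_ker.
  (* the projection to the quotient by the span and the zero map agree on all
     dju x w, hence are equal *)
  pose phi (u : vs c) (u' : vs c') : lquot S := 0.
  have [||psi [_ upsi]] := uT (lquot S) phi.
  - by move=> u k x y; rewrite /phi scaler0 addr0.
  - by move=> u k x y; rewrite /phi scaler0 addr0.
  have e1 : psi = lquot_pi S.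
    apply: upsi; split=> [k x y|u u']; first by rewrite lquot_piD lquot_piZ.
    rewrite /phi (_ : 0 = lquot_pi S 0); last by rewrite /lquot_pi raddf0.
    apply: lquot_eq; rewrite subr0 -[T u u']scale1r -[1 *: _]addr0.
    by apply: in_spanP; [exists u, u'|exact: in_span0].
  have e2 : psi = fun=> 0.
    by apply: upsi; split=> // k x y; rewrite scaler0 addr0.
  by rewrite -e1 e2.
elim=> [|k x y [u [u' ->]] _ IH].
  by rewrite -(linear_morph0 (Tr 0)) eT; exact: hQ.
apply: (lQ k (vec (T u u')) (vec y)) => //; last by rewrite eT.
by exists (dju Db c c'), (T u u'), y.
Qed.

Lemma dju_linr (X W Z : mfd n.+1) (D : dsum X W Z) (u : fld F X) a (x y z : fld F W) :
  lincomb F a x y z -> lincomb F a (dju D u x) (dju D u y) (dju D u z).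
Proof.
move=> [c [u1 [v1 [-> -> ->]]]]; have [Db [Dbl Dbr]] := bd_dsum D.
have [v <-] := (vec_image FP _ u).1 erefl.
have [T [Tr Tl eT _]] := dju_tensor FP Dbl Dbr (res u) c.
by exists (dju Db (res u) c), (T v u1), (T v v1); split; rewrite -?eT ?Tr.
Qed.

(** * Nested blobs *)

Lemma homeo_dsum d (M N A B : mfd d) (h : homeo M N) (D : dsum A B N) :
  exists D' : dsum A B M, (forall a, h (dl D' a) = dl D a) /\
                          (forall b, h (dr D' b) = dr D b).
Proof.
have hi : injective (hinv h) by exact: can_inj (hinvK h).
have e1 : embedding (hinv h \o dl D).
  by apply: embedding_comp (dl_emb D); exact: (homeo_embedding (homeo_inv h)).
have e2 : embedding (hinv h \o dr D).
  by apply: embedding_comp (dr_emb D); exact: (homeo_embedding (homeo_inv h)).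
have dis x w : (hinv h \o dl D) x <> (hinv h \o dr D) w.
  by move=> /hi; exact: dsum_disj.
have cov z : (exists x, (hinv h \o dl D) x = z) \/ (exists w, (hinv h \o dr D) w = z).
  by case: (dsum_cover D (h z)) => -[t et]; [left|right]; exists t;
    rewrite /= et hfunK.
by exists (Dsum e1 e2 dis cov); split=> t /=; rewrite hinvK.
Qed.

(** By induction from the last stage backwards: the preimages of the summands of
    a stage are summands of the previous one, and the gluing restricts to them. *)
Lemma decomp_split (N M : mfd n.+1) (t : decomp N M) (A B : mfd n.+1)
    (D : dsum A B N) :
  exists A' B' (D' : dsum A' B' M) (tA : decomp A A'),
  [/\ (forall p, total_map t (dl D' p) = dl D (total_map tA p)),
      (forall p, exists q, total_map t (dr D' p) = dr D q)
    & forall (a : fld F A') (b : fld F B') y, total_glued F t (dju D' a b) y ->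
        exists a' b', total_glued F tA a a' /\ y = dju D a' b'].
Proof.
elim: t => [M' h|M' M'' G t' [A1 [B1 [D1 [tA [h1 h2 h3]]]]]] /=.
  have [D' [e1 e2]] := homeo_dsum h D.
  exists A, B, D', (Done (homeo_id A)); split=> //= [p|a b y ->].
    by exists p.
  exists (act (homeo_id A) a), (act (homeo_id B) b); split=> //.
  exact: (dju_act FP (leqnn _)).
have [A2 [B2 [D2 [gA [gB [_ _ eA eB]]]]]] := pull_dsum D1 (gq_pl G).
have [||GA [iY [iW sA]]] := @sub_gluing _ _ _ _ _ _ _ _ G D2 D1.
- by move=> a; exists (gA a).
- by move=> a; exists (gB a).
have [||GB [jY [jW sB]]] := @sub_gluing _ _ _ _ _ _ _ _ G (dswap D2) (dswap D1).
- by move=> a; exists (gB a); exact: eB.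
- by move=> a; exists (gA a); exact: eA.
exists A2, B2, D2, (Step GA tA); split=> /= [p|p|a b y [x' gx ty]].
- by rewrite (sg_q sA) h1.
- by rewrite eB; exact: h2.
have [a' [b' [ga gb ex]]] := glued_split (leqnn _) sA sB gx.
rewrite ex in ty; have [a'' [b'' [ta ->]]] := h3 _ _ _ ty.
by exists a'', b''; split=> //; exists a'.
Qed.

Lemma stage_prefix (X M : mfd n.+1) (s : decomp X M) l :
  exists t : decomp (stage s l) M,
    (forall p, total_map s p = stage_map s l (total_map t p)) /\
    (forall (x : fld F M) y, stage_glued F s l x y -> total_glued F t x y).
Proof.
elim: s l => [M' h|M' M'' G s' IH] l /=.
  by exists (Done (homeo_id M')); split=> //= x y ->; rewrite (act_id FP).
case: l => [|l] /=.
  by exists (Done (homeo_id M')); split=> //= x y ->; rewrite (act_id FP).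
have [t [h1 h2]] := IH l; exists (Step G t); split=> //= x y [x' gx sx].
by exists x' => //; exact: h2.
Qed.

Lemma stage_path (X M : mfd n.+1) (s : decomp X M) l l' : (l <= l')%N ->
  exists t : decomp (stage s l') (stage s l),
    (forall p, stage_map s l p = stage_map s l' (total_map t p)) /\
    (forall (x : fld F M) y, stage_glued F s l' x y ->
       exists2 x', stage_glued F s l x x' & total_glued F t x' y).
Proof.
elim: s l l' => [M' h|M' M'' G s' IH] l l' ll.
  exists (Done (homeo_id M')); split=> //= x y ->.
  by exists x; rewrite // (act_id FP).
case: l ll => [|l] ll.
  have [t [h1 h2]] := stage_prefix (Step G s') l'.
  by exists t; split=> // x y /h2; exists x.
case: l' ll => // l' ll; have [t [h1 h2]] := IH l l' ll.
exists t; split=> //= x y [x' gx /h2[x'' sx tx]].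
by exists x'' => //; exists x'.
Qed.

Variable U : local_relations F.

(** Local relations form an ideal: a field whose restriction to a blob lies in U
    restricts to an element of U on any larger blob.  The larger blob lives on
    a later stage and is glued from the smaller one and some complement. *)
Lemma in_U_nested (X M : mfd n.+1) (s : decomp X M) li lj (Bi Wi Bj Wj : mfd n.+1)
    (Di : dsum Bi Wi (stage s li)) (Dj : dsum Bj Wj (stage s lj)) (x : fld F M) :
  connected (car Bi) -> connected (car Bj) -> is_ball Bi -> is_ball Bj ->
  [set stage_map s li (dl Di p) | p in setT] `<`
    [set stage_map s lj (dl Dj p) | p in setT] ->
  (forall y, stage_glued F s li x y -> in_U U Di y) ->
  forall y, stage_glued F s lj x y -> in_U U Dj y.
Proof.
move=> ci cj bi bj lt hx y sy.
have [nle sub] := nested_stages ci cj bi lt.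
have [ij|ji] := leqP li lj; last first.
  by have [t [ht _]] := stage_path s (ltnW ji); case: (nle t).
have [t [ht hs]] := stage_path s ij; have {}sub := sub t ht.
have [x' sx' tx'] := hs x y sy; have {x hx sx' hs sy} := hx x' sx'.
(* A is the part of the earlier stage that becomes Bj; A2 is the complement of
   Bi in A *)
have [A [B [D [tA [h1 h2 h3]]]]] := decomp_split t Dj.
have [f [pf ef]] : exists f, pl f /\ forall p, dl D (f p) = dl Di p.
  apply: dl_lift; first exact: (proj1 (dl_emb Di)).
  move=> p; case: (dsum_cover D (dl Di p)) => -[q eq]; first by exists q.
  have [p' ep'] := sub p; have [r er] := h2 q.
  by move: er; rewrite eq ep' => /dsum_disj.
have [P [A2 [E [gP [gA [_ _ eP eA]]]]]] := pull_dsum Di (proj1 (dl_emb D)).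
have emf : embedding f.
  by split=> // p p' e; apply: (dl_inj (D := Di)); rewrite -!ef e.
have dis p q : f p <> dr E q.
  by move=> /(congr1 (dl D)); rewrite ef eA; exact: dsum_disj.
have cov a : (exists p, f p = a) \/ (exists q, dr E q = a).
  case: (dsum_cover E a) => -[q eq]; [left|by right; exists q].
  by exists (gP q); apply: (dl_inj (D := D)); rewrite ef -eP eq.
pose Ea := Dsum emf (dr_emb E) dis cov.
have eD p : dl Di p = dl D (dl Ea p) by rewrite /= ef.
have [Ew [ew1 ew2]] := dsum_factor eD.
move=> hx'; elim: hx' y tx' => [u w Uu|a x1 x2 x3 _ IH1 _ IH2 l] y ty; last first.
  have [y1 [y2 [t1 t2 ly]]] := total_glued_lin l ty.
  by apply: (in_U_lin _ _ ly); [exact: IH1|exact: IH2].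
move: w y ty; apply: (@dju_span _ _ _ Ew) => [a b y|a w1 w2 w3 l IH1 IH2 y ty].
  rewrite -(dju_assoc FP (leqnn _) (D1 := Ea) (D2 := D)) // => ty.
  have [a' [b' [ta ->]]] := h3 _ _ _ ty; apply: in_U_dju.
  exact: (lr_ideal (l := U) bj bi Uu ta).
have [y1 [y2 [t1 t2 ly]]] := total_glued_lin (dju_linr Di u l) ty.
by apply: (in_U_lin _ _ ly); [exact: IH1|exact: IH2].
Qed.

End FieldLemmas.
(** * The differential *)

Section LinearExtension.
Variables (K : fieldType).

Lemma fglift_linear (T : choiceType) (M : lmodType K) (f : T -> M) :
  linear (fglift f : {freeg T / K} -> M).
Proof.
have sumE : {morph (fglift f : {freeg T / K} -> M) : x y / x + y}.
  move=> x y; have h := lift_is_additive f; have f0 := h 0 0.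
  rewrite !subrr in f0; rewrite -{1}[y]opprK h -[- y in LHS]sub0r h f0 sub0r opprK.
  by [].
have f0 : fglift f (0 : {freeg T / K}) = 0.
  by have := lift_is_additive f 0 0; rewrite !subrr.
have sumB (I : Type) (r : seq I) (g : I -> {freeg T / K}) :
    fglift f (\sum_(i <- r) g i) = \sum_(i <- r) fglift f (g i).
  elim: r => [|i r IH]; first by rewrite !big_nil.
  by rewrite !big_cons sumE IH.
move=> a x y; rewrite sumE; congr (_ + _).
rewrite -[x in RHS]freeg_sumE sumB scaler_sumr.
transitivity (fglift f (\sum_(z <- dom x) << a * coeff z x *g z >>)); first by [].
by rewrite sumB; apply: eq_bigr => z _; rewrite !liftU scalerA.
Qed.

Lemma fglift_gen (T : choiceType) (M : lmodType K) (f : T -> M) z :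
  fglift f (<< z >> : {freeg T / K}) = f z.
Proof. by rewrite liftU scale1r. Qed.

Lemma linear_morphD (V W : lmodType K) (f : V -> W) : linear f -> {morph f : x y / x + y}.
Proof. by move=> h x y; have := h 1 x y; rewrite !scale1r. Qed.

Lemma linear_morphZ (V W : lmodType K) (f : V -> W) a x : linear f -> f (a *: x) = a *: f x.
Proof. by move=> h; rewrite -[a *: x]addr0 h (linear_morph0 h) addr0. Qed.

Lemma linear_morph_sum (V W : lmodType K) (f : V -> W) (I : Type) (r : seq I) (g : I -> V) :
  linear f -> f (\sum_(i <- r) g i) = \sum_(i <- r) f (g i).
Proof.
move=> h; elim: r => [|i r IH]; first by rewrite !big_nil; exact: linear_morph0.
by rewrite !big_cons (linear_morphD h) IH.
Qed.

Lemma linear_comp (V V' V'' : lmodType K) (g : V' -> V'') (f : V -> V') :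
  linear g -> linear f -> linear (fun x => g (f x)).
Proof. by move=> lg lf a x y; rewrite lf lg. Qed.

Lemma in_span_ker (V W : lmodType K) (S : set V) (g : V -> W) x :
  linear g -> (forall y, S y -> g y = 0) -> in_span S x -> g x = 0.
Proof.
move=> lg hS; elim=> [|a u v Su _ IH]; first exact: linear_morph0.
by rewrite lg IH hS // scaler0 addr0.
Qed.

End LinearExtension.

Section Differential.
Variables (R : realType) (K : fieldType) (n : nat) (F : fields R K n).
Variable U : local_relations F.
Local Notation mfd := (mfd R).
Local Notation diagram := (diagram U).
Local Notation blob := (blob U).

Lemma diagram_eq (A : bmfd F) k (s t : diagram A k) :
  blobs s = blobs t -> field s = field t -> s = t.
Proof.
case: s t => [b r e p] [b' r' e' p'] /= hb hr; subst b' r'.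
by congr Diagram; exact: Prop_irrelevance.
Qed.

Lemma class_lin (A : bmfd F) k (B : 'I_k -> set A) (C : compatible B) a
    (x y z : fld F (cM C)) (s t u : diagram A k) :
  blobs s = B -> blobs t = B -> blobs u = B ->
  blob_field U x (field s) -> blob_field U y (field t) -> blob_field U z (field u) ->
  lincomb F a x y z ->
  blob_class U u = a *: blob_class U s + blob_class U t.
Proof.
move=> bs bt bu hs ht hu l.
have -> : a *: blob_class U s + blob_class U t =
    lquot_pi (@blob_rel _ _ _ _ U A k) (a *: gen s + gen t).
  by rewrite lquot_piD lquot_piZ.
apply: lquot_eq; rewrite -[_ - _]scale1r -[1 *: _]addr0.
apply: in_spanP; last exact: in_span0.
exact: (rel_lin bs bt bu hs ht hu l).
Qed.

Lemma class_perm (A : bmfd F) k (sigma : 'S_k) (s t : diagram A k) :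
  field t = field s -> blobs t = (fun i => blobs s (sigma i)) ->
  blob_class U t = (-1) ^+ sigma *: blob_class U s.
Proof.
move=> hf hb.
have -> : (-1) ^+ sigma *: blob_class U s =
    lquot_pi (@blob_rel _ _ _ _ U A k) ((-1) ^+ sigma *: gen s).
  by rewrite lquot_piZ.
apply: lquot_eq; rewrite -[_ - _]scale1r -[1 *: _]addr0.
by apply: in_spanP; [exact: rel_perm|exact: in_span0].
Qed.

(** The linear map with values f on diagrams, provided that f respects the
    relations among diagrams. *)
Definition blob_lift (A : bmfd F) k (W : lmodType K) (f : diagram A k -> W) :
  blob A k -> W :=
  fun x => fglift (f : {classic diagram A k} -> W) (generic_quotient.repr x).

Record respects (A : bmfd F) k (W : lmodType K) (f : diagram A k -> W) : Prop :=
  Respects {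
  respects_lin : forall (B : 'I_k -> set A) (C : compatible B) a
      (x y z : fld F (cM C)) (s t u : diagram A k),
    blobs s = B -> blobs t = B -> blobs u = B ->
    blob_field U x (field s) -> blob_field U y (field t) -> blob_field U z (field u) ->
    lincomb F a x y z -> f u = a *: f s + f t;
  respects_perm : forall (sigma : 'S_k) (s t : diagram A k),
    field t = field s -> blobs t = (fun i => blobs s (sigma i)) ->
    f t = (-1) ^+ sigma *: f s }.

Section BlobLift.
Variables (A : bmfd F) (k : nat) (W : lmodType K) (f : diagram A k -> W).
Hypothesis rf : respects f.
Let g := fglift (f : {classic diagram A k} -> W).
Let lg : linear g := fglift_linear _.

Lemma blob_rel_ker x : @blob_rel _ _ _ _ U A k x -> g x = 0.
Proof.
have gB y z : g (y - z) = g y - g z.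
  by have := lg (-1) z y; rewrite !scaleN1r ![- _ + _]addrC.
case=> [B C a x' y z s t u bs bt bu hs ht hu l|sigma s t hf hb].
  rewrite gB lg /g /gen !fglift_gen.
  by rewrite (respects_lin rf bs bt bu hs ht hu l) subrr.
rewrite gB (linear_morphZ _ _ lg) /g /gen !fglift_gen.
by rewrite (respects_perm rf hf hb) subrr.
Qed.

Lemma blob_lift_pi x : blob_lift f (lquot_pi (@blob_rel _ _ _ _ U A k) x) = g x.
Proof.
have := in_span_ker lg blob_rel_ker (lquot_repr (@blob_rel _ _ _ _ U A k) x).
have := lg (-1) x (generic_quotient.repr (lquot_pi (@blob_rel _ _ _ _ U A k) x)).
rewrite !scaleN1r ![- _ + _]addrC => ->.
by move=> /eqP; rewrite subr_eq0 => /eqP.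
Qed.

Lemma blob_lift_linear : linear (blob_lift f).
Proof.
move=> a x y; have [u ->] := lquot_surj x; have [v ->] := lquot_surj y.
by rewrite -[a *: _]lquot_piZ -lquot_piD !blob_lift_pi lg.
Qed.

Lemma blob_lift_class s : blob_lift f (blob_class U s) = f s.
Proof. by rewrite /blob_class blob_lift_pi /g /gen fglift_gen. Qed.

End BlobLift.

Lemma blob_ext (A : bmfd F) k (W : lmodType K) (g h : blob A k -> W) :
  linear g -> linear h ->
  (forall s, g (blob_class U s) = h (blob_class U s)) -> g =1 h.
Proof.
move=> lg lh e x; have [u ->] := lquot_surj x.
have pil : linear (lquot_pi (@blob_rel _ _ _ _ U A k)).
  by move=> a y z; rewrite lquot_piD lquot_piZ.
rewrite -[u]freeg_sumE (linear_morph_sum _ _ pil).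
rewrite (linear_morph_sum _ _ lg) (linear_morph_sum _ _ lh).
apply: eq_bigr => z _.
have -> : << coeff z u *g z >> = coeff z u *: gen (z : diagram A k).
  apply/eqP/freeg_eqP => w; rewrite coeffZ /gen !coeffU mul1r.
  by [].
rewrite (linear_morphZ _ _ pil) (linear_morphZ _ _ lg) (linear_morphZ _ _ lh).
by rewrite (e z).
Qed.

Definition forget_compatible (X : mfd n.+1) k (B : 'I_k.+1 -> set X)
    (i : 'I_k.+1) (C : compatible B) : compatible (fun j => B (fintype.lift i j)) :=
  @Compatible _ _ X k (fun j => B (fintype.lift i j)) (cM C) (cdec C)
    (fun j => clev C (fintype.lift i j)) _ _
    (fun j => cdsum C (fintype.lift i j)) 
    (fun j => @ccomp_conn _ _ _ _ _ C (fintype.lift i j))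
    (fun j => ccomp_ball C (fintype.lift i j))
    (fun j => ccomp_image C (fintype.lift i j)).

(** A twig of the smaller configuration that was not a twig before contains the
    forgotten blob, which then was itself a twig. *)
Lemma blob_field_forget (X : mfd n.+1) k (B : 'I_k.+1 -> set X) i
    (C : compatible B) (x : fld F (cM C)) r :
  blob_field U x r -> blob_field U (C := forget_compatible i C) x r.
Proof.
move=> [tr hU]; split=> // j tj; have [tw|ntw] := pselect (twig B (fintype.lift i j)).
  exact: (hU _ tw).
have only_i m : B m `<` B (fintype.lift i j) -> m = i.
  move=> lt; case: (unliftP i m) => [m' e|//].
  by case: (tj m'); rewrite -e.
have [m ltm] : exists m, B m `<` B (fintype.lift i j).
  by apply: contrapT => h; apply: ntw => m ltm; apply: h; exists m.
have ei := only_i m ltm; subst m.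
have ti : twig B i.
  move=> m ltm'; have ei : m = i.
    apply: only_i; split; first exact: subset_trans (proj1 ltm') (proj1 ltm).
    by move=> h; apply: (proj2 ltm'); exact: subset_trans (proj1 ltm) h.
  by move: ltm'; rewrite ei => -[_]; apply.
have := ltm; rewrite (ccomp_image C i) (ccomp_image C (fintype.lift i j)) => lt.
apply: (in_U_nested _ _ _ _ lt (hU i ti)).
- exact: ccomp_conn.
- exact: ccomp_conn.
- exact: ccomp_ball.
- exact: ccomp_ball.
Qed.

Lemma forget_subproof (A : bmfd F) k (i : 'I_k.+1) (s : diagram A k.+1) :
  exists (C : compatible (fun j => blobs s (fintype.lift i j))) (x : fld F (cM C)),
    blob_field U x (field s).
Proof.
have [C [x h]] := diagramP s.
by exists (forget_compatible i C), x; exact: blob_field_forget.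
Qed.

Definition forget (A : bmfd F) k (i : 'I_k.+1) (s : diagram A k.+1) : diagram A k :=
  Diagram (field_bc s) (forget_subproof i s).

Definition bd_class (A : bmfd F) k (s : diagram A k.+1) : blob A k :=
  \sum_(i < k.+1) (-1) ^+ i *: blob_class U (forget i s).

(** The permutation tau is sigma with i removed from its source and sigma i from
    its target. *)
Lemma perm_lift k (sigma : 'S_k.+1) (i : 'I_k.+1) :
  exists tau : 'S_k, sigma = lift_perm i (sigma i) tau.
Proof.
have h j : exists j', sigma (fintype.lift i j) = fintype.lift (sigma i) j'.
  have : sigma i != sigma (fintype.lift i j).
    by rewrite (inj_eq perm_inj) neq_lift.
  by move=> /unlift_some[j' e _]; exists j'.
have [g hg] := choice h.
have ig : injective g.
  move=> x y e; apply: (@lift_inj _ i); apply: (@perm_inj _ sigma).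
  by rewrite !hg e.
exists (perm ig); apply/permP => m; case: (unliftP i m) => [j ->|->].
  by rewrite lift_perm_lift permE hg.
by rewrite lift_perm_id.
Qed.

(** If sigma is obtained from tau by adding i to the source and sigma i to the
    target, then its sign is that of tau times (-1)^(i + sigma i); the factors
    (-1)^i and (-1)^(sigma i) are the coefficients of the differential. *)
Lemma bd_class_respects (A : bmfd F) k : respects (@bd_class A k).
Proof.
split=> [B C a x y z s t u bs bt bu hs ht hu l|sigma s t hf hb].
  rewrite /bd_class scaler_sumr -big_split /=; apply: eq_bigr => i _.
  rewrite scalerA mulrC -scalerA -scalerDr; congr (_ *: _).
  apply: (@class_lin A k _ (forget_compatible i C) a x y z) => //=;
    rewrite ?bs ?bt ?bu //; exact: blob_field_forget.
rewrite /bd_class scaler_sumr [RHS](reindex_inj (@perm_inj _ sigma)) /=.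
apply: eq_bigr => i _; have [tau e] := perm_lift sigma i.
rewrite (@class_perm A k tau (forget (sigma i) s)) //=; last first.
  rewrite hb; apply/funext => j; congr (blobs s _).
  by have := lift_perm_lift i (sigma i) tau j; rewrite -e => ->.
rewrite !scalerA; congr (_ *: _).
have -> : odd_perm sigma = odd i (+) odd (sigma i) (+) tau :> bool.
  by rewrite {1}e odd_lift_perm.
rewrite !signr_addb !signr_odd.
by rewrite [RHS]mulrAC -(mulrA _ _ ((-1) ^+ sigma i)) -expr2 sqrr_sign mulr1.
Qed.

Definition blob_d (A : bmfd F) k : blob A k.+1 -> blob A k := blob_lift (@bd_class A k).

Lemma blob_d_linear (A : bmfd F) k : linear (@blob_d A k).
Proof. exact: (blob_lift_linear (bd_class_respects A k)). Qed.

HB.instance Definition _ (A : bmfd F) k := GRing.isLinear.Build K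
  (blob A k.+1) (blob A k) *:%R (@blob_d A k) (@blob_d_linear A k).

Lemma blob_d_class (A : bmfd F) k (s : diagram A k.+1) :
  blob_d (blob_class U s) = bd_class s.
Proof. exact: (blob_lift_class (bd_class_respects A k)). Qed.

(** Removing first i and then j < i is the same as removing first j and then
    i - 1; this pairs off the terms of a double sum. *)
Lemma double_sum_cancel (V : zmodType) k (f : 'I_k.+2 -> 'I_k.+1 -> V) :
  (forall (i i' : 'I_k.+2) (j j' : 'I_k.+1),
     i' = j :> nat -> i = j'.+1 :> nat -> (j < i)%N -> f i j = - f i' j') ->
  \sum_i \sum_j f i j = 0.
Proof.
move=> h; rewrite pair_big /=.
rewrite (bigID (fun p : 'I_k.+2 * 'I_k.+1 => (p.2 < p.1)%N)) /=.
pose swap (p : 'I_k.+2 * 'I_k.+1) : 'I_k.+2 * 'I_k.+1 := (inord p.2, inord p.1.-1).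
pose swap' (p : 'I_k.+2 * 'I_k.+1) : 'I_k.+2 * 'I_k.+1 := (inord p.2.+1, inord p.1).
rewrite [X in _ + X](reindex_onto swap swap') /=; last first.
  move=> [i j] /= hij; rewrite -leqNgt in hij.
  have hi := ltn_ord i; have hj := ltn_ord j.
  by congr (_, _); apply: val_inj; rewrite /= !inordK //; lia.
rewrite [X in _ + X](eq_bigl (fun p : 'I_k.+2 * 'I_k.+1 => (p.2 < p.1)%N)); last first.
  move=> [i j]; have hi := ltn_ord i; have hj := ltn_ord j.
  rewrite /swap /swap' /= !inordK; try lia.
  rewrite -leqNgt; apply/andP/idP => [[h1 /eqP [h2 h3]]|hij].
    have := congr1 val h2; rewrite /= inordK; lia.
  split; first by lia.
  by apply/eqP; congr (_, _); apply: val_inj; rewrite /= inordK; lia.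
rewrite -big_split /= big1 // => -[i j] /= hij.
have hi := ltn_ord i; have hj := ltn_ord j.
by rewrite (h i (inord j) j (inord i.-1)) ?addNr // inordK //; lia.
Qed.

Lemma forget_forget (A : bmfd F) k (s : diagram A k.+2) (i i' : 'I_k.+2) (j j' : 'I_k.+1) :
  i' = j :> nat -> i = j'.+1 :> nat -> (j < i)%N ->
  forget j (forget i s) = forget j' (forget i' s).
Proof.
move=> e1 e2 hij; apply: diagram_eq => //=; apply/funext => m.
congr (blobs s _); apply: val_inj; rewrite /= /bump e1 e2.
have {hij} : (j <= j')%N by rewrite e2 ltnS in hij.
by case: (leqP j m) => h1; case: (leqP j' m) => h2 /=; lia.
Qed.

Lemma blob_dd (A : bmfd F) k (x : blob A k.+2) : blob_d (blob_d x) = 0.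
Proof.
have ld m := @blob_d_linear A m.
pose h (x : blob A k.+2) : blob A k := 0.
apply: (blob_ext (g := fun x => blob_d (blob_d x)) (h := h)).
- exact: linear_comp (ld k) (ld k.+1).
- by move=> a y z; rewrite /h scaler0 addr0.
move=> s; rewrite /h blob_d_class /bd_class (linear_morph_sum _ _ (ld k)).
under eq_bigr => i _ do rewrite (linear_morphZ _ _ (ld k)) blob_d_class /bd_class scaler_sumr.
apply: double_sum_cancel => i i' j j' e1 e2 hij.
rewrite (forget_forget s e1 e2 hij) !scalerA -!exprD -scaleNr e1 e2.
by congr (_ *: _); rewrite addSn exprS mulN1r addnC.
Qed.

End Differential.
(** * Functoriality *)

Section Push.
Variables (R : realType) (K : fieldType) (n : nat) (F : fields R K n).
Variable U : local_relations F.
Local Notation mfd := (mfd R).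
Local Notation diagram := (diagram U).
Local Notation blob := (blob U).
Let FP := fieldsP F.

Fixpoint push_decomp (X Y M : mfd n.+1) (h : homeo X Y) (s : decomp X M) : decomp Y M :=
  match s with
  | Done M g => Done (homeo_comp h g)
  | Step M M' G s' => Step G (push_decomp h s')
  end.

Lemma push_total_map (X Y M : mfd n.+1) (h : homeo X Y) (s : decomp X M) p :
  total_map (push_decomp h s) p = h (total_map s p).
Proof. by elim: s p => //= M' M'' G s' IH p; rewrite IH. Qed.

Lemma push_total_glued (X Y M : mfd n.+1) (h : homeo X Y) (s : decomp X M) (x : fld F M) r :
  total_glued F s x r -> total_glued F (push_decomp h s) x (act h r).
Proof.
elim: s x => [M' g|M' M'' G s' IH] x /=; first by move=> ->; rewrite (act_comp FP).
by move=> [x' gx tx]; exists x' => //; exact: IH.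
Qed.

(** A stage with its map to the glued manifold and with the relation between a
    field on M and the fields glued from it, packaged so that the stages of two
    decompositions can be compared by an equality. *)
Definition stage_data (X M : mfd n.+1) (s : decomp X M) l :
    {N : mfd n.+1 & ((N -> X) * (fld F M -> fld F N -> Prop))%type} :=
  existT _ (stage s l) (stage_map s l, stage_glued F s l).

Lemma push_stage_data (X Y M : mfd n.+1) (h : homeo X Y) (s : decomp X M) l :
  stage_data (push_decomp h s) l =
  existT _ (stage s l) (h \o stage_map s l, stage_glued F s l).
Proof.
elim: s l => [M' g|M' M'' G s' IH] l; first by [].
case: l => [|l].
  rewrite /stage_data /=; congr existT; congr (_, _).
  by apply/funext => p; rewrite push_total_map.
pose Phi (d : {N : mfd n.+1 & ((N -> Y) * (fld F M'' -> fld F N -> Prop))%type}) :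
    {N : mfd n.+1 & ((N -> Y) * (fld F M' -> fld F N -> Prop))%type} :=
  existT _ (projT1 d) ((projT2 d).1,
    fun x y => exists2 x', glued G x x' & (projT2 d).2 x' y).
exact: (congr1 Phi (IH l)).
Qed.

(** The components of stages are the same before and after pushing forward.  The
    types of the stages are equal but not convertible, so the data are found
    through the equality of the packaged stages.  The map e is the identity, up
    to the type of its target. *)
Lemma push_compatible (X Y : mfd n.+1) (h : homeo X Y) k (B : 'I_k -> set X)
    (C : compatible B) :
  exists (C' : compatible (fun i => h @` B i)) (e : fld F (cM C) -> fld F (cM C')),
    (forall a x y z, lincomb F a x y z -> lincomb F a (e x) (e y) (e z)) /\
    (forall x r, blob_field U x r -> blob_field U (e x) (act h r)).
Proof.
pose s' := push_decomp h (cdec C).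
pose good i (d : {N : mfd n.+1 & ((N -> Y) * (fld F (cM C) -> fld F N -> Prop))%type}) :=
  exists t : {BW : mfd n.+1 * mfd n.+1 & dsum BW.1 BW.2 (projT1 d)},
  [/\ connected (car (projT1 t).1), is_ball (projT1 t).1,
      h @` B i = [set (projT2 d).1 (dl (projT2 t) p) | p in setT]
    & forall x, (forall y, stage_glued F (cdec C) (clev C i) x y -> in_U U (cdsum C i) y) ->
        forall y, (projT2 d).2 x y -> in_U U (projT2 t) y].
have H i : good i (stage_data s' (clev C i)).
  rewrite push_stage_data /good /=.
  exists (existT _ (ccomp C i, crest C i) (cdsum C i)); split=> //=.
  - exact: ccomp_conn.
  - exact: ccomp_ball.
  - by rewrite {1}(ccomp_image C i) image_comp.
pose w i := cid (H i).
exists (@Compatible _ _ Y k (fun i => h @` B i) (cM C) s' (clev C)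
  (fun i => (projT1 (sval (w i))).1) (fun i => (projT1 (sval (w i))).2)
  (fun i => projT2 (sval (w i)))
  (fun i => let: And4 c _ _ _ := svalP (w i) in c)
  (fun i => let: And4 _ b _ _ := svalP (w i) in b)
  (fun i => let: And4 _ _ m _ := svalP (w i) in m)), id; split=> // x r [tr hU].
split; first exact: push_total_glued.
move=> i ti /= y sy; have [_ _ _ hw] := svalP (w i).
apply: (hw x _ y sy); apply: hU => j [sub nsub]; apply: (ti j); split.
  exact: image_subset.
move=> hs; apply: nsub => p Bp; have [|q Bq] := hs (h p); first by exists p.
by move=> /(can_inj (hfunK h)) <-.
Qed.

Lemma push_bc (A B : bmfd F) (f : bhomeo A B) (s : fld F A) :
  res s = bc A -> res (act (sval f) s) = bc B.
Proof.
by case: f => f [g rf ef] /= e; rewrite (act_res FP (leqnn _) rf) e.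
Qed.

Lemma push_subproof (A B : bmfd F) (f : bhomeo A B) k (s : diagram A k) :
  exists (C : compatible (fun i => (sval f : homeo A B) @` blobs s i)) (x : fld F (cM C)),
    blob_field U x (act (sval f) (field s)).
Proof.
have [C [x hx]] := diagramP s; have [C' [e [_ he]]] := push_compatible (sval f) C.
by exists C', (e x); exact: he.
Qed.

Definition push (A B : bmfd F) (f : bhomeo A B) k (s : diagram A k) : diagram B k :=
  Diagram (push_bc f (field_bc s)) (push_subproof f s).

Definition push_class (A B : bmfd F) (f : bhomeo A B) k (s : diagram A k) : blob B k :=
  blob_class U (push f s).

Lemma push_class_respects (A B : bmfd F) (f : bhomeo A B) k :
  respects (@push_class A B f k).
Proof.
split=> [Bs C a x y z s t u bs bt bu hs ht hu l|sigma s t hf hb].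
  have [C' [e [le he]]] := push_compatible (sval f) C.
  apply: (class_lin (C := C') (x := e x) (y := e y) (z := e z)) => //=;
    rewrite ?bs ?bt ?bu //; solve [exact: he | exact: le].
apply: class_perm => /=; first by rewrite hf.
by rewrite hb.
Qed.

Definition blob_map (A B : bmfd F) (f : bhomeo A B) k : blob A k -> blob B k :=
  blob_lift (@push_class A B f k).

Lemma blob_map_linear (A B : bmfd F) (f : bhomeo A B) k : linear (@blob_map A B f k).
Proof. exact: (blob_lift_linear (push_class_respects f k)). Qed.

Lemma blob_map_class (A B : bmfd F) (f : bhomeo A B) k (s : diagram A k) :
  blob_map f (blob_class U s) = blob_class U (push f s).
Proof. exact: (blob_lift_class (push_class_respects f k)). Qed.

Lemma blob_map_id (A : bmfd F) k (x : blob A k) : blob_map (bhomeo_id A) x = x.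
Proof.
apply: (blob_ext (g := @blob_map _ _ (bhomeo_id A) k) (h := id)) => //.
  exact: blob_map_linear.
move=> s; rewrite blob_map_class; congr blob_class; apply: diagram_eq => /=.
  by apply/funext => i; rewrite image_id.
exact: (act_id FP).
Qed.

Lemma blob_map_comp (A B C : bmfd F) (g : bhomeo B C) (f : bhomeo A B) k (x : blob A k) :
  blob_map (bhomeo_comp g f) x = blob_map g (blob_map f x).
Proof.
have lf := @blob_map_linear _ _ f k; have lg := @blob_map_linear _ _ g k.
apply: (blob_ext (g := @blob_map _ _ (bhomeo_comp g f) k)
  (h := fun x => blob_map g (blob_map f x))).
- exact: blob_map_linear.
- exact: linear_comp lg lf.
move=> s; rewrite !blob_map_class; congr blob_class; apply: diagram_eq => /=.
  by apply/funext => i; rewrite image_comp.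
exact: (act_comp FP).
Qed.

Lemma blob_map_d (A B : bmfd F) (f : bhomeo A B) k (x : blob A k.+1) :
  blob_map f (blob_d x) = blob_d (blob_map f x).
Proof.
have lf m := @blob_map_linear _ _ f m.
have ld (X : bmfd F) := @blob_d_linear _ _ _ _ U X k.
apply: (blob_ext (g := fun x => blob_map f (blob_d x))
  (h := fun x => blob_d (blob_map f x))).
- exact: linear_comp (lf k) (ld A).
- exact: linear_comp (ld B) (lf k.+1).
move=> s; rewrite blob_map_class !blob_d_class /bd_class (linear_morph_sum _ _ (lf k)).
apply: eq_bigr => i _; rewrite (linear_morphZ _ _ (lf k)) blob_map_class.
by congr (_ *: blob_class U _); exact: diagram_eq.
Qed.

Definition bhomeo_inv (A B : bmfd F) (f : bhomeo A B) : bhomeo B A.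
Proof.
exists (homeo_inv (sval f)); case: f => f [g rf ef] /=.
exists (homeo_inv g) => [p|].
  apply: (can_inj (hfunK f)); rewrite -rf /=.
  by rewrite (hinvK f) (hinvK g).
rewrite -ef -(act_comp FP) // -[RHS](act_id FP) //; congr act.
by apply: homeo_eq => p /=; rewrite hfunK.
Defined.

Lemma bhomeo_invK (A B : bmfd F) (f : bhomeo A B) :
  bhomeo_comp (bhomeo_inv f) f = bhomeo_id A.
Proof. by apply: bhomeo_eq => p /=; rewrite hfunK. Qed.

Lemma bhomeo_invKV (A B : bmfd F) (f : bhomeo A B) :
  bhomeo_comp f (bhomeo_inv f) = bhomeo_id B.
Proof. by apply: bhomeo_eq => p /=; rewrite hinvK. Qed.

Lemma blob_map_bij (A B : bmfd F) (f : bhomeo A B) k : bijective (@blob_map A B f k).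
Proof.
exists (@blob_map B A (bhomeo_inv f) k) => x; rewrite -blob_map_comp.
  by rewrite bhomeo_invK blob_map_id.
by rewrite bhomeo_invKV blob_map_id.
Qed.

End Push.

Theorem mainTheorem1 (R : realType) (K : fieldType) (n : nat)
    (F : fields R K n) (U : local_relations F) :
  exists (d : forall (X : bmfd F) k, {linear blob U X k.+1 -> blob U X k})
         (dd : forall X k x, d X k (d X k.+1 x) = 0),
    (forall (X : bmfd F) k (s : diagram U X k.+1),
       exists t : 'I_k.+1 -> diagram U X k,
         (forall i, forgets i s (t i)) /\
         d X k (blob_class U s) = \sum_(i < k.+1) (-1) ^+ i *: blob_class U (t i)) /\
    exists B : functor_on
        (fun X : manifolds F => Complex (dd X) : complexes K),
      forall (X Y : manifolds F) (f : mor X Y) k (s : diagram U X k),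
        exists t : diagram U Y k,
          transports (sval f) s t /\
          cmap (fmor B f) (blob_class U s) = blob_class U t.
Proof.
exists (fun X k => @blob_d _ _ _ _ U X k : {linear _ -> _}).
exists (fun X k x => blob_dd x).
split=> [X k s|].
  by exists (fun i => forget i s); split=> //; exact: blob_d_class.
pose C (X : manifolds F) : complexes K := Complex (fun k x => @blob_dd _ _ _ _ U X k x).
pose m (X Y : manifolds F) (f : mor X Y) : mor (C X) (C Y) :=
  @ChainIso K (C X) (C Y) (fun k => @blob_map _ _ _ _ U X Y f k)
    (fun k => @blob_map_linear _ _ _ _ U X Y f k)
    (fun k => @blob_map_bij _ _ _ _ U X Y f k)
    (fun k => @blob_map_d _ _ _ _ U X Y f k).
have m1 (X : manifolds F) : m X X (idm X) = idm (C X).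
  by apply: chain_iso_eq => k x /=; exact: blob_map_id.
have mc (X Y Z : manifolds F) (g : mor Y Z) (f : mor X Y) :
    m X Z (cmp g f) = cmp (m Y Z g) (m X Y f).
  by apply: chain_iso_eq => k x /=; exact: blob_map_comp.
exists (FunctorOn m1 mc) => X Y f k s; exists (push f s); split=> //.
exact: blob_map_class.
Qed.
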